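(* Cut elimination holds for $LJ^{=}_1$, $LJ^{=}_2$, $LK^{=}_1$ and $LK^{=}_2$; that is, every sequent derivable in one of these calculi has a derivation in the same calculus that does not use the cut rule.
   Context: The language is first-order with equality and function symbols; free and bound object variables are syntactically distinct, and terms contain only free variables. A sequent $\Gamma\Rightarrow\Delta$ consists of two finite sequences of formulae. $F\{v/t\}$ is the result of simultaneously replacing all occurrences of the free object variable $v$ in $F$ by the term $t$. $LK$ is Gentzen's classical sequent calculus: logical axioms $F\Rightarrow F$ for every formula $F$; the structural rules of left and right weakening, exchange and contraction, and the cut rule (from $\Gamma\Rightarrow\Delta,F$ and $\Lambda,F\Rightarrow\Theta$ infer $\Gamma,\Lambda\Rightarrow\Delta,\Theta$); and the usual left and right logical rules for $\neg,\wedge,\vee,\to,\forall,\exists$, where the left rule for $\forall$ and the right rule for $\exists$ may be instantiated with an arbitrary term. $LJ$ is Gentzen's intuitionistic calculus, in which all sequents have at most one formula in the succedent. Equality rules ($F$ any formula, $r,s$ terms, $v$ a free object variable occurring neither in $r$ nor in $s$): $(=_1)$: from $\Gamma\Rightarrow\Delta,F\{v/r\}$ infer $\Gamma,r=s\Rightarrow\Delta,F\{v/s\}$; $(=_2)$: from $\Gamma\Rightarrow\Delta,F\{v/r\}$ infer $\Gamma,s=r\Rightarrow\Delta,F\{v/s\}$; $(=_1^l)$: from $\Gamma,F\{v/r\}\Rightarrow\Delta$ infer $\Gamma,F\{v/s\},r=s\Rightarrow\Delta$; $(=_2^l)$: from $\Gamma,F\{v/r\}\Rightarrow\Delta$ infer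 $\Gamma,F\{v/s\},s=r\Rightarrow\Delta$. In the intuitionistic calculi, $\Delta=\emptyset$ in $=_1,=_2$ and $|\Delta|\le1$ in $=_1^l,=_2^l$. For $i=1,2$, $LJ^{=}_i$ and $LK^{=}_i$ are obtained from $LJ$ and $LK$ respectively by adding the Reflexivity Axiom $\Rightarrow t=t$ (for every term $t$) and the two rules $=_i$ and $=_i^l$. *)

(* Defs.v *)
From Stdlib Require List.
From mathcomp Require Import all_boot.

Set Implicit Arguments.
Unset Strict Implicit.
Unset Printing Implicit Defensive.

Record language := Language {
  fsym : Type; farity : fsym -> nat;
  psym : Type; parity : psym -> nat
}.

(* Free variables are named by natural numbers; bound variables are well-scoped
   de Bruijn indices, so that formulae are taken up to renaming of bound
   variables.  [sterm L n] and [sform L n] are the expressions with at most [n]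
   dangling bound variables; index 0 is the innermost one. *)
Inductive sterm (L : language) (n : nat) : Type :=
  | FVar of nat
  | BVar of 'I_n
  | App (f : fsym L) of {ffun 'I_(farity f) -> sterm L n}.

Arguments FVar {L n}.
Arguments BVar {L n}.
Arguments App {L n}.

Inductive sform (L : language) : nat -> Type :=
  | Atom n (p : psym L) of {ffun 'I_(parity p) -> sterm L n} : sform L n
  | Eq n of sterm L n & sterm L n : sform L n
  | Neg n of sform L n : sform L n
  | And n of sform L n & sform L n : sform L n
  | Or n of sform L n & sform L n : sform L n
  | Imp n of sform L n & sform L n : sform L n
  | All n of sform L n.+1 : sform L n
  | Ex n of sform L n.+1 : sform L n.

Notation term L := (sterm L 0).
Notation formula L := (sform L 0).

(* Simultaneous substitution of free variables by [rho] and of dangling bound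
   variables by [sigma]. *)
Fixpoint tbind L n m (rho : nat -> sterm L m) (sigma : 'I_n -> sterm L m)
    (t : sterm L n) : sterm L m :=
  match t with
  | FVar v => rho v
  | BVar i => sigma i
  | App f ts => App f [ffun k => tbind rho sigma (ts k)]
  end.

Definition shift L n (t : sterm L n) : sterm L n.+1 :=
  tbind FVar (fun i => BVar (lift ord0 i)) t.

Definition up L n m (sigma : 'I_n -> sterm L m) (i : 'I_n.+1) : sterm L m.+1 :=
  if unlift ord0 i is Some j then shift (sigma j) else BVar ord0.

Fixpoint fbind L n (A : sform L n) : forall m,
    (nat -> sterm L m) -> ('I_n -> sterm L m) -> sform L m :=
  match A in sform _ n
    return forall m, (nat -> sterm L m) -> ('I_n -> sterm L m) -> sform L m with
  | Atom _ p ts => fun _ rho sigma => Atom [ffun k => tbind rho sigma (ts k)]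
  | Eq _ s t => fun _ rho sigma => Eq (tbind rho sigma s) (tbind rho sigma t)
  | Neg _ B => fun _ rho sigma => Neg (fbind B rho sigma)
  | And _ B C => fun _ rho sigma => And (fbind B rho sigma) (fbind C rho sigma)
  | Or _ B C => fun _ rho sigma => Or (fbind B rho sigma) (fbind C rho sigma)
  | Imp _ B C => fun _ rho sigma => Imp (fbind B rho sigma) (fbind C rho sigma)
  | All _ B => fun _ rho sigma => All (fbind B (fun v => shift (rho v)) (up sigma))
  | Ex _ B => fun _ rho sigma => Ex (fbind B (fun v => shift (rho v)) (up sigma))
  end.

(* [fsubst F v t] is $F\{v/t\}$. *)
Definition fsubst L (F : formula L) (v : nat) (t : term L) : formula L :=
  fbind F (fun w => if w == v then t else FVar w) BVar.

(* The instance, at the term [t], of the quantified formula with body [A]. *)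
Definition inst L (A : sform L 1) (t : term L) : formula L :=
  fbind A FVar (fun _ => t).

Fixpoint toccurs L n (v : nat) (t : sterm L n) : bool :=
  match t with
  | FVar w => w == v
  | BVar _ => false
  | App f ts => [exists k, toccurs v (ts k)]
  end.

Fixpoint foccurs L n (v : nat) (A : sform L n) : bool :=
  match A with
  | Atom _ p ts => [exists k, toccurs v (ts k)]
  | Eq _ s t => toccurs v s || toccurs v t
  | Neg _ B => foccurs v B
  | And _ B C | Or _ B C | Imp _ B C => foccurs v B || foccurs v C
  | All _ B | Ex _ B => foccurs v B
  end.

Record sequent (L : language) := Sequent {
  antecedent : seq (formula L);
  succedent : seq (formula L)
}.

Notation "Γ ⇒ Δ" := (Sequent Γ Δ) (at level 70, no associativity).

Definition soccurs L (v : nat) (S : sequent L) : bool :=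
  has (foccurs v) (antecedent S) || has (foccurs v) (succedent S).

(* A set of inference rules: [R prems concl] means that [concl] may be inferred
   from the list of premises [prems]; axioms have no premises. *)
Definition rules (L : language) := seq (sequent L) -> sequent L -> Prop.

Inductive derivable L (R : rules L) : sequent L -> Prop :=
  | Derivable prems concl :
      R prems concl ->
      (forall S, List.In S prems -> derivable R S) ->
      derivable R concl.

Inductive gentzen_rule L : rules L :=
  | Ax F : gentzen_rule [::] ([:: F] ⇒ [:: F])
  | WeakL Γ Δ F : gentzen_rule [:: Γ ⇒ Δ] (rcons Γ F ⇒ Δ)
  | WeakR Γ Δ F : gentzen_rule [:: Γ ⇒ Δ] (Γ ⇒ rcons Δ F)
  | ExchL Γ Λ Δ F G :
      gentzen_rule [:: Γ ++ F :: G :: Λ ⇒ Δ] (Γ ++ G :: F :: Λ ⇒ Δ)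
  | ExchR Γ Δ Θ F G :
      gentzen_rule [:: Γ ⇒ Δ ++ F :: G :: Θ] (Γ ⇒ Δ ++ G :: F :: Θ)
  | ContrL Γ Δ F : gentzen_rule [:: rcons (rcons Γ F) F ⇒ Δ] (rcons Γ F ⇒ Δ)
  | ContrR Γ Δ F : gentzen_rule [:: Γ ⇒ rcons (rcons Δ F) F] (Γ ⇒ rcons Δ F)
  | NegL Γ Δ F : gentzen_rule [:: Γ ⇒ rcons Δ F] (rcons Γ (Neg F) ⇒ Δ)
  | NegR Γ Δ F : gentzen_rule [:: rcons Γ F ⇒ Δ] (Γ ⇒ rcons Δ (Neg F))
  | AndL1 Γ Δ F G : gentzen_rule [:: rcons Γ F ⇒ Δ] (rcons Γ (And F G) ⇒ Δ)
  | AndL2 Γ Δ F G : gentzen_rule [:: rcons Γ G ⇒ Δ] (rcons Γ (And F G) ⇒ Δ)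
  | AndR Γ Δ F G :
      gentzen_rule [:: Γ ⇒ rcons Δ F; Γ ⇒ rcons Δ G] (Γ ⇒ rcons Δ (And F G))
  | OrL Γ Δ F G :
      gentzen_rule [:: rcons Γ F ⇒ Δ; rcons Γ G ⇒ Δ] (rcons Γ (Or F G) ⇒ Δ)
  | OrR1 Γ Δ F G : gentzen_rule [:: Γ ⇒ rcons Δ F] (Γ ⇒ rcons Δ (Or F G))
  | OrR2 Γ Δ F G : gentzen_rule [:: Γ ⇒ rcons Δ G] (Γ ⇒ rcons Δ (Or F G))
  | ImpL Γ Λ Δ Θ F G :
      gentzen_rule [:: Γ ⇒ rcons Δ F; rcons Λ G ⇒ Θ]
        (rcons (Γ ++ Λ) (Imp F G) ⇒ Δ ++ Θ)
  | ImpR Γ Δ F G : gentzen_rule [:: rcons Γ F ⇒ rcons Δ G] (Γ ⇒ rcons Δ (Imp F G))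
  | AllL Γ Δ (A : sform L 1) t :
      gentzen_rule [:: rcons Γ (inst A t) ⇒ Δ] (rcons Γ (All A) ⇒ Δ)
  | AllR Γ Δ (A : sform L 1) v :
      ~~ soccurs v (Γ ⇒ rcons Δ (All A)) ->
      gentzen_rule [:: Γ ⇒ rcons Δ (inst A (FVar v))] (Γ ⇒ rcons Δ (All A))
  | ExL Γ Δ (A : sform L 1) v :
      ~~ soccurs v (rcons Γ (Ex A) ⇒ Δ) ->
      gentzen_rule [:: rcons Γ (inst A (FVar v)) ⇒ Δ] (rcons Γ (Ex A) ⇒ Δ)
  | ExR Γ Δ (A : sform L 1) t :
      gentzen_rule [:: Γ ⇒ rcons Δ (inst A t)] (Γ ⇒ rcons Δ (Ex A)).

Inductive cut_rule L : rules L :=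
  | Cut Γ Λ Δ Θ F :
      cut_rule [:: Γ ⇒ rcons Δ F; rcons Λ F ⇒ Θ] (Γ ++ Λ ⇒ Δ ++ Θ).

Inductive eq_rule1 L : rules L :=
  | Eq1 Γ Δ F v r s : ~~ toccurs v r -> ~~ toccurs v s ->
      eq_rule1 [:: Γ ⇒ rcons Δ (fsubst F v r)]
        (rcons Γ (Eq r s) ⇒ rcons Δ (fsubst F v s))
  | Eq1l Γ Δ F v r s : ~~ toccurs v r -> ~~ toccurs v s ->
      eq_rule1 [:: rcons Γ (fsubst F v r) ⇒ Δ]
        (rcons (rcons Γ (fsubst F v s)) (Eq r s) ⇒ Δ).

Inductive eq_rule2 L : rules L :=
  | Eq2 Γ Δ F v r s : ~~ toccurs v r -> ~~ toccurs v s ->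
      eq_rule2 [:: Γ ⇒ rcons Δ (fsubst F v r)]
        (rcons Γ (Eq s r) ⇒ rcons Δ (fsubst F v s))
  | Eq2l Γ Δ F v r s : ~~ toccurs v r -> ~~ toccurs v s ->
      eq_rule2 [:: rcons Γ (fsubst F v r) ⇒ Δ]
        (rcons (rcons Γ (fsubst F v s)) (Eq s r) ⇒ Δ).

Inductive refl_rule L : rules L :=
  | Refl t : refl_rule [::] ([::] ⇒ [:: Eq t t]).

Definition rules_union L (R1 R2 : rules L) : rules L :=
  fun prems concl => R1 prems concl \/ R2 prems concl.

Infix "∪" := rules_union (at level 50, left associativity).

(* The instances of [R] all of whose sequents have at most one formula in the
   succedent.  Such instances of the right contraction and right exchange rules
   do not exist, and the other rules become those of the intuitionistic
   calculus: e.g. the side succedent of the first premise is empty in [Cut] and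
   [ImpL]. *)
Definition intuitionistic L (R : rules L) : rules L :=
  fun prems concl => R prems concl /\
    forall S, List.In S (concl :: prems) -> size (succedent S) <= 1.

Definition LK1_cutfree L : rules L := @gentzen_rule L ∪ @refl_rule L ∪ @eq_rule1 L.
Definition LK2_cutfree L : rules L := @gentzen_rule L ∪ @refl_rule L ∪ @eq_rule2 L.
Definition LJ1_cutfree L : rules L := intuitionistic (LK1_cutfree (L := L)).
Definition LJ2_cutfree L : rules L := intuitionistic (LK2_cutfree (L := L)).

Definition LK1 L : rules L := LK1_cutfree (L := L) ∪ @cut_rule L.
Definition LK2 L : rules L := LK2_cutfree (L := L) ∪ @cut_rule L.
Definition LJ1 L : rules L := intuitionistic (LK1 (L := L)).
Definition LJ2 L : rules L := intuitionistic (LK2 (L := L)).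

(* Main.v *)
From mathcomp Require Import all_boot.
From Stdlib Require List.
From Stdlib Require Import Relation_Operators FunctionalExtensionality.
Require Import Defs.

Set Implicit Arguments.
Unset Strict Implicit.
Unset Printing Implicit Defensive.

(** The proof is semantic: cut is sound in a model whose elements are built from
the sequents derivable without cut, and validity in that model gives back
derivability without cut. Neither derivations with cut nor cut-free ones are
ever transformed.

A context [c] and a test [τ] are sequents; [c ⊕ τ] juxtaposes them. In the
intuitionistic case a context has an empty succedent and a test has at most one
formula in it, so that [c ⊕ τ] is again an intuitionistic sequent; classically
both are arbitrary. A formula is interpreted by a set of contexts that is closed: it contains every context
[c] such that [c ⊕ τ] is derivable for all the tests [τ] that are derivable
together with each of its elements. The connectives get the operations of the
Heyting algebra of closed sets, and quantifiers range over all terms. The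
logical rules and cut are then sound ([gentzen_sound], [cut_sound]), and the
rules introducing a connective say exactly that the context [A ⇒] belongs to
the interpretation of [A] and that the test [⇒ A] accepts all of it
([adequacy]); hence validity of [Γ ⇒ Δ] entails its derivability
([completeness]).

What remains is to interpret equations and atoms so that replacement is sound in
both directions, although each calculus only rewrites in one. Say that [c]
asserts [A] if [A] may be dropped from an antecedent in favour of [c]. In the
calculus with index 1, if [c] asserts [r = q] then, reading rules upwards, every
[q] may be turned into [r] on either side of a sequent that contains [c]: the
rewriting relation [q ~> r]. The left rule applied to the equation itself shows
that asserted equations are closed under rewriting their right-hand sides: if
[c] asserts [r = q] and [q ~> q'], then [c] asserts [r = q'], whence [q' ~> r].
So an overlap of [q ~> r] with a rewriting [q ~> q'] inside [q] is always closed
by the derived equation, parallel rewriting has the diamond property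
([par_diamond]), and two terms are convertible iff they rewrite to a common
term. This turns an arbitrary equational deduction of [s = t] into a cut-free
proof: from the axiom [⇒ w = w] for the common reduct [w], rewriting yields
[⇒ s = t] ([conv_prov_eq]); from [P(w) ⇒ P(w)] it yields
[P(s) ⇒ P(t)] ([conv_prov_atom]). Therefore [s = t] may be interpreted by the
closure of the set of contexts in which [s] and [t] are convertible, and an atom
likewise modulo convertibility. Convertibility is an equivalence and a
congruence, so full replacement holds in the model ([interp_leibniz]).

The calculus with index 2 differs only by the orientation of the equation that
licenses [q ~> r]. *)

(** * Substitution *)

(** The generated induction principle has no hypothesis for the arguments of a
function symbol, which are nested inside a finite function. *)
Lemma sterm_nested_ind (L : language) n (P : sterm L n -> Prop) :
  (forall v, P (FVar v)) -> (forall i, P (BVar i)) ->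
  (forall f (ts : {ffun 'I_(farity f) -> sterm L n}),
    (forall k, P (ts k)) -> P (App f ts)) -> forall t, P t.
Proof.
move=> Hv Hb Ha; fix IH 1; case=> [v|i|f ts]; [exact: Hv|exact: Hb|].
by apply: Ha => k; apply: IH.
Qed.

Section Substitution.
Variable L : language.

Lemma eq_tbind n m (rho rho' : nat -> sterm L m) (sigma sigma' : 'I_n -> sterm L m)
    (t : sterm L n) :
  (forall v, toccurs v t -> rho v = rho' v) -> sigma =1 sigma' ->
  tbind rho sigma t = tbind rho' sigma' t.
Proof.
move=> Hr Hs; elim/sterm_nested_ind: t Hr => /= [v|i|f ts IH] Hr.
- exact: Hr.
- exact: Hs.
congr App; apply/ffunP=> k; rewrite !ffunE; apply: IH => v Hv; apply: Hr.
by apply/existsP; exists k.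
Qed.

Lemma eq_up n m (sigma sigma' : 'I_n -> sterm L m) :
  sigma =1 sigma' -> up sigma =1 up sigma'.
Proof. by move=> H i; rewrite /up; case: unlift => // j; rewrite H. Qed.

Lemma eq_fbind n (A : sform L n) m (rho rho' : nat -> sterm L m)
    (sigma sigma' : 'I_n -> sterm L m) :
  (forall v, foccurs v A -> rho v = rho' v) -> sigma =1 sigma' ->
  fbind A rho sigma = fbind A rho' sigma'.
Proof.
elim: A m rho rho' sigma sigma' => {n} /=
  [n p ts|n s t|n A IH|n A IHA B IHB|n A IHA B IHB|n A IHA B IHB|n A IH|n A IH]
  m rho rho' sigma sigma' Hr Hs.
- congr Atom; apply/ffunP=> k; rewrite !ffunE; apply: eq_tbind => // v Hv.
  by apply: Hr; apply/existsP; exists k.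
- by congr Eq; apply: eq_tbind => // v Hv; apply: Hr; rewrite Hv ?orbT.
- by congr Neg; apply: IH.
- by congr And; [apply: IHA|apply: IHB] => // v Hv; apply: Hr; rewrite Hv ?orbT.
- by congr Or; [apply: IHA|apply: IHB] => // v Hv; apply: Hr; rewrite Hv ?orbT.
- by congr Imp; [apply: IHA|apply: IHB] => // v Hv; apply: Hr; rewrite Hv ?orbT.
- by congr All; apply: IH; [move=> v /Hr ->|apply: eq_up].
- by congr Ex; apply: IH; [move=> v /Hr ->|apply: eq_up].
Qed.

Lemma tbind_tbind n m p (rho : nat -> sterm L m) (sigma : 'I_n -> sterm L m)
    (rho' : nat -> sterm L p) (sigma' : 'I_m -> sterm L p) t :
  tbind rho' sigma' (tbind rho sigma t) =
  tbind (fun v => tbind rho' sigma' (rho v)) (fun i => tbind rho' sigma' (sigma i)) t.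
Proof.
elim/sterm_nested_ind: t => //= f ts IH.
by congr App; apply/ffunP=> k; rewrite !ffunE.
Qed.

Lemma tbind_id n (t : sterm L n) : tbind FVar BVar t = t.
Proof.
elim/sterm_nested_ind: t => //= f ts IH.
by congr App; apply/ffunP=> k; rewrite ffunE.
Qed.

Lemma up_id n : up (BVar (L := L)) =1 BVar (n := n.+1).
Proof.
move=> i; rewrite /up; case: unliftP => [j ->|-> //].
by rewrite /shift.
Qed.

Lemma fbind_id n (A : sform L n) : fbind A FVar BVar = A.
Proof.
elim: A => {n} /= [n p ts|n s t|n A IH|n A IHA B IHB|n A IHA B IHB|n A IHA B IHB
  |n A IH|n A IH].
- by congr Atom; apply/ffunP=> k; rewrite !ffunE tbind_id.
- by rewrite !tbind_id.
- by rewrite IH.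
- by rewrite IHA IHB.
- by rewrite IHA IHB.
- by rewrite IHA IHB.
- by congr All; rewrite -[RHS]IH; apply: eq_fbind => //; apply: up_id.
- by congr Ex; rewrite -[RHS]IH; apply: eq_fbind => //; apply: up_id.
Qed.

Lemma tbind_shift n m (rho : nat -> sterm L m) (sigma : 'I_n -> sterm L m) t :
  tbind (fun v => shift (rho v)) (up sigma) (shift t) = shift (tbind rho sigma t).
Proof.
rewrite /shift !tbind_tbind; apply: eq_tbind => [v _ //|i /=].
by rewrite /up liftK.
Qed.

Lemma fbind_fbind n (A : sform L n) m p (rho : nat -> sterm L m)
    (sigma : 'I_n -> sterm L m) (rho' : nat -> sterm L p) (sigma' : 'I_m -> sterm L p) :
  fbind (fbind A rho sigma) rho' sigma' =
  fbind A (fun v => tbind rho' sigma' (rho v)) (fun i => tbind rho' sigma' (sigma i)).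
Proof.
have Hup n0 m0 p0 (s : 'I_n0 -> sterm L m0) (r' : nat -> sterm L p0) s' i :
    tbind (fun v => shift (r' v)) (up s') (up s i) = up (fun i => tbind r' s' (s i)) i.
  rewrite {2 3}/up; case: unliftP => [j _|_ /=]; first exact: tbind_shift.
  by rewrite /up unlift_none.
elim: A m p rho sigma rho' sigma' => {n} /=
  [n q ts|n s t|n A IH|n A IHA B IHB|n A IHA B IHB|n A IHA B IHB|n A IH|n A IH]
  m p rho sigma rho' sigma'.
- by congr Atom; apply/ffunP=> k; rewrite !ffunE tbind_tbind.
- by rewrite !tbind_tbind.
- by rewrite IH.
- by rewrite IHA IHB.
- by rewrite IHA IHB.
- by rewrite IHA IHB.
- by rewrite IH; congr All; apply: eq_fbind => [v _|i]; [apply: tbind_shift|apply: Hup].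
- by rewrite IH; congr Ex; apply: eq_fbind => [v _|i]; [apply: tbind_shift|apply: Hup].
Qed.

Lemma finite_bound n (P : 'I_n -> nat -> Prop) :
  (forall k, exists N, forall v, N <= v -> P k v) ->
  exists N, forall v, N <= v -> forall k, P k v.
Proof.
move=> /fin_all_exists[N HN]; exists (\max_k N k) => v Hv k.
by apply: HN; apply: leq_trans Hv; apply: leq_bigmax.
Qed.

Lemma toccurs_bound n (t : sterm L n) : exists N, forall v, N <= v -> ~~ toccurs v t.
Proof.
elim/sterm_nested_ind: t => /= [w|i|f ts /finite_bound[N HN]].
- by exists w.+1 => v; apply: contraTN => /eqP->; rewrite ltnn.
- by exists 0.
by exists N => v Hv; apply/existsPn=> k; apply: HN.
Qed.

Lemma foccurs_bound n (A : sform L n) : exists N, forall v, N <= v -> ~~ foccurs v A.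
Proof.
have two (P Q : nat -> bool) : (exists N, forall v, N <= v -> ~~ P v) ->
    (exists N, forall v, N <= v -> ~~ Q v) -> exists N, forall v, N <= v -> ~~ (P v || Q v).
  move=> [N HN] [M HM]; exists (maxn N M) => v; rewrite geq_max => /andP[/HN/negbTE-> /HM].
  by [].
elim: A => {n} /= [n p ts|n s t|n A IH|n A IHA B IHB|n A IHA B IHB|n A IHA B IHB
  |n A IH|n A IH] //; try exact: two.
  have [N HN] := finite_bound (fun k => toccurs_bound (ts k)).
  by exists N => v Hv; apply/existsPn=> k; apply: HN.
by apply: two; apply: toccurs_bound.
Qed.

Lemma soccurs_bound (S : sequent L) : exists N, forall v, N <= v -> ~~ soccurs v S.
Proof.
have H (Γ : seq (formula L)) : exists N, forall v, N <= v -> ~~ has (foccurs v) Γ.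
  elim: Γ => [|A Γ [N HN]]; first by exists 0.
  have [M HM] := foccurs_bound A; exists (maxn M N) => v.
  by rewrite geq_max /= => /andP[/HM/negbTE-> /HN].
case: (H (antecedent S)) => N HN; case: (H (succedent S)) => M HM.
exists (maxn N M) => v; rewrite geq_max => /andP[/HN H1 /HM H2].
by rewrite /soccurs (negbTE H1).
Qed.

Lemma fsubst_rename (F : formula L) v u t :
  ~~ foccurs u F -> fsubst (fsubst F v (FVar u)) u t = fsubst F v t.
Proof.
move=> Hu; rewrite /fsubst fbind_fbind; apply: eq_fbind => // w Hw.
case: eqP => _ /=; first by rewrite eqxx.
by case: eqP => // E; move: Hw; rewrite E (negbTE Hu).
Qed.

(** The environment extending [sigma] by the value [t] of a newly opened
binder, whose index is 0. *)
Definition scons n (t : term L) (sigma : 'I_n -> term L) (i : 'I_n.+1) : term L :=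
  if unlift ord0 i is Some j then sigma j else t.

Lemma tbind_scons_shift n rho (sigma : 'I_n -> term L) t (s : sterm L n) :
  tbind rho (scons t sigma) (shift s) = tbind rho sigma s.
Proof.
rewrite /shift tbind_tbind; apply: eq_tbind => //= i.
by rewrite /scons liftK.
Qed.

Lemma inst_fbind n (A : sform L n.+1) rho (sigma : 'I_n -> term L) t :
  inst (fbind A (fun v => shift (rho v)) (up sigma)) t = fbind A rho (scons t sigma).
Proof.
have E s : tbind FVar (fun=> t) (shift s) = s.
  rewrite /shift tbind_tbind -[RHS]tbind_id.
  by apply: eq_tbind => // -[].
rewrite /inst fbind_fbind; apply: eq_fbind => [v _|i]; first exact: E.
by rewrite /up /scons; case: unlift => [j|//]; apply: E.
Qed.

End Substitution.

(** * Finite functions, one argument at a time *)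

Definition upd n T (ts : {ffun 'I_n -> T}) (k : 'I_n) (x : T) : {ffun 'I_n -> T} :=
  [ffun j => if j == k then x else ts j].

(** The replacement rules act on one occurrence pattern at a time; changing all
arguments of a symbol is done by passing through the families [mix i], whose
first [i] arguments have been changed. *)
Lemma rel_pointwise n T U (R : T -> T -> Prop) (RU : U -> U -> Prop)
    (g : {ffun 'I_n -> T} -> U) :
  (forall x, RU x x) -> (forall x y z, RU x y -> RU y z -> RU x z) ->
  (forall ts k a b, R a b -> RU (g (upd ts k a)) (g (upd ts k b))) ->
  forall ts ts' : {ffun 'I_n -> T}, (forall k, R (ts k) (ts' k)) -> RU (g ts) (g ts').
Proof.
move=> refl trans step ts ts' H.
pose mix i := [ffun j : 'I_n => if j < i then ts' j else ts j].
have Hmix i : i <= n -> RU (g ts) (g (mix i)).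
  elim: i => [_|i IH Hi].
    by have -> : mix 0 = ts by apply/ffunP=> j; rewrite ffunE.
  apply: trans (IH (ltnW Hi)) _; pose k := Ordinal Hi.
  have -> : mix i = upd (mix i) k (ts k).
    by apply/ffunP=> j; rewrite !ffunE; case: eqP => // ->; rewrite ltnn.
  have -> : mix i.+1 = upd (mix i) k (ts' k).
    apply/ffunP=> j; rewrite !ffunE ltnS leq_eqVlt.
    by case: (eqVneq j k) => [->|]; rewrite ?eqxx // -val_eqE /= => /negbTE->.
  exact: step.
have -> : ts' = mix n by apply/ffunP=> j; rewrite ffunE ltn_ord.
exact: Hmix.
Qed.

(** * Derivability without cut, up to the structural rules *)

Lemma In_cat T (x : T) s t : List.In x (s ++ t) <-> List.In x s \/ List.In x t.
Proof. by elim: s => /= [|y s IH]; tauto. Qed.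

Lemma In_rcons T (x y : T) s : List.In x (rcons s y) <-> List.In x s \/ x = y.
Proof. by rewrite -cats1 In_cat /=; intuition. Qed.

Definition eq_rule d (L : language) : rules L :=
  if d then @eq_rule1 L else @eq_rule2 L.

(** The flag [int] selects the intuitionistic calculus, and [d] the orientation
of the replacement rules, so that one proof covers the four calculi. *)
Definition cutfree int d (L : language) : rules L :=
  let R := @gentzen_rule L ∪ @refl_rule L ∪ @eq_rule d L in
  if int then intuitionistic R else R.

Definition withcut int d (L : language) : rules L :=
  let R := @gentzen_rule L ∪ @refl_rule L ∪ @eq_rule d L ∪ @cut_rule L in
  if int then intuitionistic R else R.

Definition merge L (S T : sequent L) : sequent L :=
  antecedent S ++ antecedent T ⇒ succedent S ++ succedent T.

Infix "⊕" := merge (at level 50, left associativity).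

Definition subsequent L (S T : sequent L) : Prop :=
  List.incl (antecedent S) (antecedent T) /\ List.incl (succedent S) (succedent T).

(** Sequents matter below only up to the sets of their formulas: [prov_sub]
absorbs all structural rules into goals of this form. *)
Ltac solve_sub :=
  split; let X := fresh "X" in move=> X; cbn;
  rewrite ?In_rcons ?In_cat; cbn; rewrite ?In_rcons ?In_cat; cbn;
  intuition (subst; auto).

Section Provability.
Variables (L : language) (int d : bool).

Definition prov := derivable (cutfree int d (L := L)).
(** Juxtaposing a context and a test must yield a sequent of the calculus. *)
Definition test (S : sequent L) := int -> size (succedent S) <= 1.
Definition ctx (S : sequent L) := int -> succedent S = [::].

Lemma prov_test S : prov S -> test S.
Proof.
case=> prems concl; rewrite /cutfree; case Ei: int => H _ Hi.
  by case: H => _; apply; left.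
by move: Hi; rewrite Ei.
Qed.

Lemma prov_rule prems concl :
  (@gentzen_rule L ∪ @refl_rule L ∪ @eq_rule d L) prems concl ->
  test concl -> (forall S, List.In S prems -> prov S) -> prov concl.
Proof.
move=> H Hc Hp; apply: (Derivable (prems := prems)) => //.
rewrite /cutfree; case Ei: int => //; split=> // S [<-|HS]; first by apply: Hc; rewrite Ei.
by have := prov_test (Hp _ HS); apply; rewrite Ei.
Qed.

Lemma prov_gentzen1 S concl :
  gentzen_rule [:: S] concl -> test concl -> prov S -> prov concl.
Proof.
move=> H Hc HS; apply: (prov_rule _ Hc) (_ : _); first by left; left; exact: H.
by move=> T [<-|[]].
Qed.

Lemma prov_gentzen2 S S' concl :
  gentzen_rule [:: S; S'] concl -> test concl -> prov S -> prov S' -> prov concl.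
Proof.
move=> H Hc HS HS'; apply: (prov_rule _ Hc) (_ : _); first by left; left; exact: H.
by move=> T [<-|[<-|[]]].
Qed.

Lemma prov_move_last_left Γ Λ Δ F :
  prov (Γ ++ F :: Λ ⇒ Δ) <-> prov (rcons (Γ ++ Λ) F ⇒ Δ).
Proof.
elim: Λ Γ => [|G Λ IH] Γ; first by rewrite cats0 -cats1.
rewrite -[_ ++ G :: Λ]cat_rcons -IH cat_rcons.
split=> H; apply: (prov_gentzen1 (ExchL _ _ _ _ _) _ H); exact: (prov_test H).
Qed.

Lemma prov_contract_left Γ Γ' Δ F :
  List.In F Γ' -> prov (F :: Γ ++ Γ' ⇒ Δ) -> prov (Γ ++ Γ' ⇒ Δ).
Proof.
move=> /(List.in_split (A := formula L))[A [B ->]] H; rewrite catA; apply/prov_move_last_left.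
apply: (prov_gentzen1 (ContrL _ _ _)); first exact: (prov_test H).
have: prov (rcons (Γ ++ A ++ F :: B) F ⇒ Δ) by apply/(prov_move_last_left [::]).
by rewrite -cats1 -!catA cat_cons catA => /prov_move_last_left; rewrite catA cats1 -catA.
Qed.

Lemma prov_sub_left Γ Γ' Δ : prov (Γ ⇒ Δ) -> List.incl Γ Γ' -> prov (Γ' ⇒ Δ).
Proof.
move=> H Hi; have: prov (Γ ++ Γ' ⇒ Δ).
  elim/last_ind: {Hi} Γ' => [|Γ' F IH]; first by rewrite cats0.
  rewrite -rcons_cat; apply: (prov_gentzen1 (WeakL _ _ _) _ IH); exact: (prov_test H).
elim: {H} Γ Hi => [|F Γ IH] Hi //= H; apply: IH => [X HX|]; first by apply: Hi; right.
by apply: prov_contract_left H; apply: Hi; left.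
Qed.

Lemma prov_move_last_right Γ Δ Θ F : ~~ int ->
  prov (Γ ⇒ Δ ++ F :: Θ) <-> prov (Γ ⇒ rcons (Δ ++ Θ) F).
Proof.
move=> /negP Hi; elim: Θ Δ => [|G Θ IH] Δ; first by rewrite cats0 -cats1.
rewrite -[_ ++ G :: Θ]cat_rcons -IH cat_rcons.
by split=> H; apply: (prov_gentzen1 (ExchR _ _ _ _ _) _ H) => /Hi.
Qed.

Lemma prov_contract_right Γ Δ Δ' F : ~~ int ->
  List.In F Δ' -> prov (Γ ⇒ F :: Δ ++ Δ') -> prov (Γ ⇒ Δ ++ Δ').
Proof.
move=> Hi /(List.in_split (A := formula L))[A [B ->]] H; rewrite catA.
apply/(prov_move_last_right _ _ _ _ Hi).
apply: (prov_gentzen1 (ContrR _ _ _)); first by move=> E; rewrite E in Hi.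
have: prov (Γ ⇒ rcons (Δ ++ A ++ F :: B) F) by apply/(prov_move_last_right _ [::] _ _ Hi).
rewrite -cats1 -!catA cat_cons catA => /(prov_move_last_right _ _ _ _ Hi).
by rewrite catA cats1 -catA.
Qed.

(** In the intuitionistic case there is neither exchange nor contraction on the
right, but then the inclusion is an equality or starts from the empty list. *)
Lemma prov_sub_right Γ Δ Δ' : test (Γ ⇒ Δ') ->
  prov (Γ ⇒ Δ) -> List.incl Δ Δ' -> prov (Γ ⇒ Δ').
Proof.
case: (boolP int) => Hint Ht H Hi; last first.
  have: prov (Γ ⇒ Δ ++ Δ').
    elim/last_ind: {Hi Ht} Δ' => [|Δ' F IH]; first by rewrite cats0.
    by rewrite -rcons_cat; apply: (prov_gentzen1 (WeakR _ _ _) _ IH) => E; rewrite E in Hint.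
  elim: {H} Δ Hi => [|F Δ IH] Hi //= H; apply: IH => [X HX|]; first by apply: Hi; right.
  by apply: prov_contract_right H => //; apply: Hi; left.
have := prov_test H Hint; have /= := Ht Hint; move: Hi H {Ht}.
case: Δ => [|A [|? ?]] //=; case: Δ' => [|B [|? ?]] //= Hi H _ _.
- exact: (prov_gentzen1 (WeakR _ [::] B)).
- by case: (Hi A (or_introl erefl)).
- by case: (Hi A (or_introl erefl)) => // <- in H *.
Qed.

Lemma prov_sub S S' : prov S -> subsequent S S' -> test S' -> prov S'.
Proof.
case: S S' => Γ Δ [Γ' Δ'] H [/= HΓ HΔ] Ht.
by apply: prov_sub_right Ht _ HΔ; apply: prov_sub_left H HΓ.
Qed.

Lemma ctx_test c : ctx c -> test c.
Proof. by move=> H Hi; rewrite H. Qed.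

Lemma ctx_merge c c' : ctx c -> ctx c' -> ctx (c ⊕ c').
Proof. by move=> H H' Hi /=; rewrite H // H'. Qed.

Lemma test_merge c τ : ctx c -> test τ -> test (c ⊕ τ).
Proof. by move=> H H' Hi /=; rewrite H //; apply: H'. Qed.

Lemma test_mergeC c τ : ctx c -> test τ -> test (τ ⊕ c).
Proof. by move=> H H' Hi /=; rewrite H // cats0; apply: H'. Qed.

Lemma ctx_left Γ : ctx (Γ ⇒ [::]).
Proof. by []. Qed.

Lemma test_right Γ A : test (Γ ⇒ [:: A]).
Proof. by []. Qed.

End Provability.

#[local] Hint Resolve ctx_test ctx_merge test_merge test_mergeC ctx_left test_right : core.

(** * Equational reasoning without cut *)

Section Equations.
Variables (L : language) (int d : bool).
Notation prov := (@prov L int d).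
Notation ctx := (@ctx L int).
Notation test := (@test L int).

(** The equation that allows replacing [r] by [q] from premise to conclusion. *)
Definition equation (r q : term L) : formula L := if d then Eq r q else Eq q r.

(** That is, [c] lies in the closed set generated by the context [A ⇒]. *)
Definition asserts (c : sequent L) (A : formula L) : Prop :=
  forall τ, test τ -> prov (([:: A] ⇒ [::]) ⊕ τ) -> prov (c ⊕ τ).

(** Under [c], the formula [A] may be turned into [B] when rules are read
upwards, in the antecedent as well as in the succedent. *)
Definition reduces (c : sequent L) (A B : formula L) : Prop :=
  (forall τ, test τ ->
     prov (([:: B] ⇒ [::]) ⊕ τ) -> prov (([:: A] ⇒ [::]) ⊕ c ⊕ τ)) /\
  (forall δ, ctx δ ->
     prov (([::] ⇒ [:: B]) ⊕ δ) -> prov (([::] ⇒ [:: A]) ⊕ c ⊕ δ)).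

Lemma reduces_refl c A : ctx c -> reduces c A A.
Proof.
by move=> Hc; split=> τ Ht H; apply: prov_sub H _ _; auto 6; solve_sub.
Qed.

Lemma reduces_trans c A B C : ctx c -> reduces c A B -> reduces c B C -> reduces c A C.
Proof.
move=> Hc [H1 H2] [H3 H4]; split=> τ Ht H.
- have H5: prov (([:: B] ⇒ [::]) ⊕ (c ⊕ τ)).
    by apply: prov_sub (H3 _ Ht H) _ _; auto 6; solve_sub.
  by apply: prov_sub (H1 _ _ H5) _ _; auto 6; solve_sub.
- have H5: prov (([::] ⇒ [:: B]) ⊕ (c ⊕ τ)).
    by apply: prov_sub (H4 _ Ht H) _ _; auto 6; solve_sub.
  by apply: prov_sub (H2 _ _ H5) _ _; auto 6; solve_sub.
Qed.

Lemma equation_left (F : formula L) v r q Γ Δ :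
  ~~ toccurs v r -> ~~ toccurs v q -> test (Γ ⇒ Δ) ->
  prov (rcons Γ (fsubst F v r) ⇒ Δ) ->
  prov (rcons (rcons Γ (fsubst F v q)) (equation r q) ⇒ Δ).
Proof.
move=> Hr Hq Ht H; apply: (prov_rule (prems := [:: rcons Γ (fsubst F v r) ⇒ Δ])) => //.
  by right; rewrite /eq_rule /equation; case: d; [apply: Eq1l|apply: Eq2l].
by move=> S [<-|[]].
Qed.

Lemma equation_right (F : formula L) v r q Γ Δ :
  ~~ toccurs v r -> ~~ toccurs v q ->
  prov (Γ ⇒ rcons Δ (fsubst F v r)) ->
  prov (rcons Γ (equation r q) ⇒ rcons Δ (fsubst F v q)).
Proof.
move=> Hr Hq H; apply: (prov_rule (prems := [:: Γ ⇒ rcons Δ (fsubst F v r)])) => //.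
- by right; rewrite /eq_rule /equation; case: d; [apply: Eq1|apply: Eq2].
- by move=> Hi; have:= prov_test H Hi; rewrite /= !size_rcons.
- by move=> S [<-|[]].
Qed.

(** The variable [v] may occur in [r] or [q], which the replacement rules forbid
for the variable marking the places; it is first renamed to a fresh one. *)
Lemma equation_reduces c r q F v : ctx c -> asserts c (equation r q) ->
  reduces c (fsubst F v q) (fsubst F v r).
Proof.
move=> Hc Ha.
have [N HN] := foccurs_bound F; have [M HM] := toccurs_bound r.
have [K HK] := toccurs_bound q; pose u := maxn N (maxn M K).
have Hu : ~~ foccurs u F by apply: HN; rewrite leq_maxl.
have Hr : ~~ toccurs u r by apply: HM; rewrite /u maxnCA leq_maxl.
have Hq : ~~ toccurs u q by apply: HK; rewrite /u maxnA leq_maxr.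
rewrite -(fsubst_rename v r Hu) -(fsubst_rename v q Hu); move: (fsubst F v _) => {HN Hu} G.
split=> τ Ht H.
- have H1: prov (rcons (antecedent τ) (fsubst G u r) ⇒ succedent τ).
    by apply: prov_sub H _ _; auto; solve_sub.
  have H2: prov (([:: equation r q] ⇒ [::]) ⊕ (([:: fsubst G u q] ⇒ [::]) ⊕ τ)).
    by apply: prov_sub (equation_left Hr Hq Ht H1) _ _; auto; solve_sub.
  by apply: prov_sub (Ha _ _ H2) _ _; auto; solve_sub.
- have H1: prov (antecedent τ ⇒ rcons (succedent τ) (fsubst G u r)).
    apply: prov_sub H _ _; first by solve_sub.
    by move=> Hi /=; rewrite Ht.
  have H2: prov (([:: equation r q] ⇒ [::]) ⊕ (([::] ⇒ [:: fsubst G u q]) ⊕ τ)).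
    by apply: prov_sub (equation_right Hr Hq H1) _ _; auto; solve_sub.
  by apply: prov_sub (Ha _ _ H2) _ _; auto 6; solve_sub.
Qed.

Definition treduces (c : sequent L) (a b : term L) : Prop :=
  forall F v, reduces c (fsubst F v a) (fsubst F v b).

(** A replacement rule only reaches positions marked by a variable; the
hypothesis on [g] provides such marks for its arguments. *)
Lemma treduces_pointwise c n (g : {ffun 'I_n -> term L} -> formula L)
    (ts ts' : {ffun 'I_n -> term L}) : ctx c ->
  (forall us k, exists F u, forall x, g (upd us k x) = fsubst F u x) ->
  (forall k, treduces c (ts k) (ts' k)) -> reduces c (g ts) (g ts').
Proof.
move=> Hc hole; apply: rel_pointwise => [A|A B C|us k a b Hab].
- exact: reduces_refl.
- exact: reduces_trans.
- by have [F [u E]] := hole us k; rewrite !E.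
Qed.

Lemma tsubst_fresh (t : term L) u x : ~~ toccurs u t ->
  tbind (fun w => if w == u then x else FVar w) BVar t = t.
Proof.
move=> Hu; rewrite -[RHS]tbind_id; apply: eq_tbind => // w Hw.
by case: eqP => // E; rewrite -E Hw in Hu.
Qed.

Lemma tsubst_upd n (ts : {ffun 'I_n -> term L}) k u x : (forall k, ~~ toccurs u (ts k)) ->
  [ffun j => tbind (fun w => if w == u then x else FVar w) BVar (upd ts k (FVar u) j)]
  = upd ts k x.
Proof.
move=> Hu; apply/ffunP=> j; rewrite !ffunE; case: eqP => _ /=; first by rewrite eqxx.
exact: tsubst_fresh.
Qed.

Lemma atom_hole (p : psym L) (ts : {ffun 'I_(parity p) -> term L}) k :
  exists F u, forall x, Atom (upd ts k x) = fsubst F u x.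
Proof.
have [u Hu] := finite_bound (fun k => toccurs_bound (ts k)).
exists (Atom (upd ts k (FVar u))), u => x; rewrite /fsubst /=.
by rewrite tsubst_upd // => j; apply: Hu.
Qed.

Lemma app_hole (F : formula L) v f (ts : {ffun 'I_(farity f) -> term L}) k :
  exists G u, forall x, fsubst F v (App f (upd ts k x)) = fsubst G u x.
Proof.
have [N HN] := finite_bound (fun k => toccurs_bound (ts k)).
have [M HM] := foccurs_bound F; pose u := maxn N M.
exists (fsubst F v (App f (upd ts k (FVar u)))), u => x.
rewrite /fsubst fbind_fbind; apply: eq_fbind => // w Hw.
case: eqP => _ /=; first by rewrite tsubst_upd // => j; apply: HN; rewrite leq_maxl.
by case: eqP => // E; move: (HM u); rewrite -E Hw E leq_maxr => /(_ isT).
Qed.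

Lemma treduces_eq c a b a' b' : ctx c -> treduces c a a' -> treduces c b b' ->
  reduces c (Eq a b) (Eq a' b').
Proof.
move=> Hc Ha Hb; have [u Hu] := toccurs_bound b; have [u' Hu'] := toccurs_bound a'.
have := Ha (Eq (FVar u) b) u; have := Hb (Eq a' (FVar u')) u'.
rewrite /fsubst /= !eqxx !(tsubst_fresh _ (Hu _ _)) // !(tsubst_fresh _ (Hu' _ _)) //.
by move=> H1 H2; apply: reduces_trans H1.
Qed.

(** Parallel rewriting by the equations [D r q], from [q] to [r]: unlike its
one-step version it has the diamond property, not just local confluence. *)
Inductive par (D : term L -> term L -> Prop) : term L -> term L -> Prop :=
  | par_root r q : D r q -> par D q r
  | par_var v : par D (FVar v) (FVar v)
  | par_app f (ts ts' : {ffun 'I_(farity f) -> term L}) :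
      (forall k, par D (ts k) (ts' k)) -> par D (App f ts) (App f ts').

Lemma par_refl D t : par D t t.
Proof.
elim/sterm_nested_ind: t => [v|[]//|f ts IH]; [exact: par_var|exact: par_app].
Qed.

Lemma par_mono (D D' : term L -> term L -> Prop) a b :
  (forall r q, D r q -> D' r q) -> par D a b -> par D' a b.
Proof. by move=> H; elim=> *; [apply: par_root; auto|apply: par_var|apply: par_app]. Qed.

Lemma par_inv D a b : par D a b ->
  D b a \/ match a with
           | App f ts => exists2 ts', b = App f ts' & forall k, par D (ts k) (ts' k)
           | _ => b = a
           end.
Proof. by case=> *; [left|right|right; eauto]. Qed.

(** By the closure of [D], a root step [q ~> r] and any other step [q ~> q']
yield the rule [q' ~> r], which closes the overlap; steps below the root are
joined argument by argument. *)
Lemma par_diamond (D : term L -> term L -> Prop) :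
  (forall r q q', D r q -> par D q q' -> D r q') ->
  forall a b b', par D a b -> par D a b' -> exists2 w, par D b w & par D b' w.
Proof.
move=> HD a b b' Hb; elim: Hb b' => {a b} [r q Hrq|v|f ts ts' Hts IH] b' Hb'.
- by exists r; [apply: par_refl|apply: par_root; apply: HD Hb'].
- by exists b' => //; apply: par_refl.
- have [HDb|[us E Hus]] := par_inv Hb'.
    exists b'; last exact: par_refl.
    by apply: par_root; apply: HD HDb _; apply: par_app.
  have /fin_all_exists2[ws H1 H2] := fun k => IH k _ (Hus k).
  exists (App f (finfun ws)); rewrite ?E; apply: par_app => k; rewrite ffunE //.
Qed.

Definition rewrites (c : sequent L) : term L -> term L -> Prop :=
  clos_refl_trans _ (par (fun r q => asserts c (equation r q))).

Definition conv (c : sequent L) (s t : term L) : Prop :=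
  exists2 w, rewrites c s w & rewrites c t w.

Lemma par_treduces c a b : ctx c ->
  par (fun r q => asserts c (equation r q)) a b -> treduces c a b.
Proof.
move=> Hc; elim=> {a b} [r q Ha|v|f ts ts' _ IH] F u.
- exact: equation_reduces.
- exact: reduces_refl.
- by apply: (treduces_pointwise (g := fun ts => fsubst F u (App f ts))) => // us k; apply: app_hole.
Qed.

Lemma rewrites_treduces c a b : ctx c -> rewrites c a b -> treduces c a b.
Proof.
move=> Hc; elim=> [x y H|x F v|x y z _ H1 _ H2 F v].
- exact: par_treduces.
- exact: reduces_refl.
- exact: reduces_trans (H1 F v) (H2 F v).
Qed.

(** The heart of the matter: the left replacement rule, used on the equation
[r = q'] itself, produces the closure of the rewrite rules that makes
rewriting confluent. *)
Lemma asserts_par c r q q' : ctx c -> asserts c (equation r q) ->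
  par (fun r q => asserts c (equation r q)) q q' -> asserts c (equation r q').
Proof.
move=> Hc Ha Hq τ Ht H.
have [Hred _] : reduces c (equation r q) (equation r q').
  have Hr : treduces c r r by move=> F v; apply: reduces_refl.
  by rewrite /equation; case: d; apply: treduces_eq => //; apply: par_treduces.
have H1: prov (([:: equation r q] ⇒ [::]) ⊕ (c ⊕ τ)).
  by apply: prov_sub (Hred _ Ht H) _ _; auto; solve_sub.
by apply: prov_sub (Ha _ _ H1) _ _; auto; solve_sub.
Qed.

Lemma rewrites_confluent c a b b' : ctx c -> rewrites c a b -> rewrites c a b' ->
  exists2 w, rewrites c b w & rewrites c b' w.
Proof.
move=> Hc.
have dia := par_diamond (fun r q q' H => @asserts_par c r q q' Hc H).
have strip x y : rewrites c x y -> forall z, par (fun r q => asserts c (equation r q)) x z ->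
    exists2 w, par (fun r q => asserts c (equation r q)) y w & rewrites c z w.
  elim=> {x y} [x y H z Hz|x z Hz|x y z _ IH1 _ IH2 u Hu].
  - by have [w Hw Hw'] := dia _ _ _ H Hz; exists w => //; apply: rt_step.
  - by exists z => //; apply: rt_refl.
  - have [w Hw Hw'] := IH1 _ Hu; have [w' H1 H2] := IH2 _ Hw.
    by exists w' => //; apply: rt_trans H2.
move=> Hb; move=> Hb'; elim: Hb' b Hb => {a b'} [x y H z Hz|x z Hz|x y z _ IH1 _ IH2 u Hu].
- by have [w Hw Hw'] := strip _ _ Hz _ H; exists w => //; apply: rt_step.
- by exists z => //; apply: rt_refl.
- have [w Hw Hw'] := IH1 _ Hu; have [w' H1 H2] := IH2 _ Hw'.
  by exists w' => //; apply: rt_trans H1.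
Qed.

Lemma conv_refl c t : conv c t t.
Proof. by exists t; apply: rt_refl. Qed.

Lemma conv_sym c s t : conv c s t -> conv c t s.
Proof. by case=> w; exists w. Qed.

Lemma conv_trans c s t u : ctx c -> conv c s t -> conv c t u -> conv c s u.
Proof.
move=> Hc [w H1 H2] [w' H3 H4]; have [x Hx Hx'] := rewrites_confluent Hc H2 H3.
by exists x; [apply: rt_trans Hx|apply: rt_trans Hx'].
Qed.

Lemma asserts_mono c c' A : ctx c' -> subsequent c c' -> asserts c A -> asserts c' A.
Proof.
move=> Hc' [H1 H2] H τ Ht /(H _ Ht) H'; apply: prov_sub H' _ _; auto.
by split=> X /=; rewrite !In_cat => -[]; auto.
Qed.

Lemma conv_mono c c' s t : ctx c' -> subsequent c c' -> conv c s t -> conv c' s t.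
Proof.
move=> Hc' Hs; have mono x y : rewrites c x y -> rewrites c' x y.
  elim=> {x y} [x y H|x|x y z _ H1 _ H2]; [apply: rt_step|exact: rt_refl|exact: rt_trans H2].
  by apply: par_mono H => r q; apply: asserts_mono.
by case=> w Hw Hw'; exists w; apply: mono.
Qed.

Lemma conv_app c f (ts ts' : {ffun 'I_(farity f) -> term L}) :
  (forall k, conv c (ts k) (ts' k)) -> conv c (App f ts) (App f ts').
Proof.
move=> /fin_all_exists2[ws H1 H2].
have app (us : {ffun 'I_(farity f) -> term L}) :
      (forall k, rewrites c (us k) (ws k)) -> rewrites c (App f us) (App f (finfun ws)).
  move=> H; apply: (rel_pointwise (R := rewrites c)); [exact: rt_refl|exact: rt_trans| |
    by move=> k; rewrite ffunE].
  move=> {H} vs k a b; elim=> {a b} [a b H|a|a b e _ Ha _ Hb];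
    [apply: rt_step|exact: rt_refl|exact: rt_trans Hb].
  by apply: par_app => j; rewrite !ffunE; case: eqP => // _; apply: par_refl.
by exists (App f (finfun ws)); apply: app.
Qed.

Lemma conv_tbind c n (rho rho' : nat -> term L) (sigma sigma' : 'I_n -> term L) t :
  (forall v, conv c (rho v) (rho' v)) -> (forall i, conv c (sigma i) (sigma' i)) ->
  conv c (tbind rho sigma t) (tbind rho' sigma' t).
Proof.
move=> Hr Hs; elim/sterm_nested_ind: t => //= f ts IH.
by apply: conv_app => k; rewrite !ffunE.
Qed.

(** The orientation decides which of the two terms rewrites to the other. *)
Lemma asserts_conv c s t : asserts c (Eq s t) -> conv c s t.
Proof.
have one r q : asserts c (equation r q) -> conv c q r.
  by move=> H; exists r; [apply/rt_step/par_root|apply: rt_refl].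
by move=> H; case E: d; [apply/conv_sym|]; apply: one; rewrite /equation E.
Qed.

(** Start from [⇒ w = w], for a common reduct [w], and rewrite both sides. *)
Lemma conv_prov_eq c s t : ctx c -> conv c s t -> prov (c ⊕ ([::] ⇒ [:: Eq s t])).
Proof.
move=> Hc [w Hs Ht].
have [_ H] := treduces_eq Hc (rewrites_treduces Hc Hs) (rewrites_treduces Hc Ht).
have H1 : prov (([::] ⇒ [:: Eq w w]) ⊕ c).
  apply: (@prov_sub _ _ _ ([::] ⇒ [:: Eq w w])); [|solve_sub|auto].
  by apply: (prov_rule (prems := [::])) => //; left; right; apply: Refl.
by apply: prov_sub (H _ Hc H1) _ _; auto; solve_sub.
Qed.

(** Start from the axiom on the atom whose arguments are common reducts; the
left replacement rule then leads to the arguments [ts'], the right one to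
[ts]. *)
Lemma conv_prov_atom c (p : psym L) (ts ts' : {ffun 'I_(parity p) -> term L}) :
  ctx c -> (forall k, conv c (ts' k) (ts k)) ->
  prov (([:: Atom ts'] ⇒ [::]) ⊕ (c ⊕ ([::] ⇒ [:: Atom ts]))).
Proof.
move=> Hc /fin_all_exists2[ws H1 H2].
have red (us : {ffun 'I_(parity p) -> term L}) :
      (forall k, rewrites c (us k) (ws k)) -> reduces c (Atom us) (Atom (finfun ws)).
  move=> H; apply: (treduces_pointwise (g := @Atom L 0 p)) => // [us' k|k].
    exact: atom_hole.
  by rewrite ffunE; apply: rewrites_treduces.
have [Hl _] := red _ H1; have [_ Hr] := red _ H2; move: (Atom (finfun ws)) Hl Hr => W Hl Hr.
have H : prov (([:: W] ⇒ [::]) ⊕ ([::] ⇒ [:: W])).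
  by apply: (prov_rule (prems := [::])) => //; left; left; apply: Ax.
have H3 : prov (([::] ⇒ [:: W]) ⊕ (([:: Atom ts'] ⇒ [::]) ⊕ c)).
  by apply: prov_sub (Hl _ _ H) _ _; auto; solve_sub.
by apply: prov_sub (Hr _ _ H3) _ _; auto; solve_sub.
Qed.

End Equations.

(** * A model built from the sequents derivable without cut *)

Section Model.
Variables (L : language) (int d : bool).
Notation prov := (@prov L int d).
Notation ctx := (@ctx L int).
Notation test := (@test L int).
Notation asserts := (@asserts L int d).
Notation conv := (@conv L int d).

(** [dual] and the condition in [cl] are the two halves of a Galois connection
between contexts and tests, and [cl] is the closure operator that it induces. *)
Definition dual (X : sequent L -> Prop) (τ : sequent L) : Prop :=
  test τ /\ forall c, X c -> prov (c ⊕ τ).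

Definition cl (X : sequent L -> Prop) (c : sequent L) : Prop :=
  ctx c /\ forall τ, dual X τ -> prov (c ⊕ τ).

(** The closure of [P(us) ⇒] for a single [us] would not be invariant under
convertibility of arguments in the given context, so atoms are interpreted modulo
it. *)
Definition atom_value (p : psym L) (ts : {ffun 'I_(parity p) -> term L}) : sequent L -> Prop :=
  cl (fun c => ctx c /\ exists2 us : {ffun 'I_(parity p) -> term L},
    asserts c (Atom us) & forall k, conv c (us k) (ts k)).

Definition eq_value (s t : term L) : sequent L -> Prop :=
  cl (fun c => ctx c /\ conv c s t).

Definition all_value (V : term L -> sequent L -> Prop) (c : sequent L) : Prop :=
  forall t, V t c.

Definition ex_value (V : term L -> sequent L -> Prop) : sequent L -> Prop :=
  cl (fun c => exists t, V t c).

(** Quantifiers range over terms, so formulas with dangling indices are evaluated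
in an environment [sigma] of terms. In the classical case every closed set is
its own double negation, so that the same clauses serve both calculi. *)
Fixpoint interp n (A : sform L n) :
    (nat -> term L) -> ('I_n -> term L) -> sequent L -> Prop :=
  match A in sform _ n
    return (nat -> term L) -> ('I_n -> term L) -> sequent L -> Prop with
  | Atom _ p ts => fun rho sigma => atom_value [ffun k => tbind rho sigma (ts k)]
  | Eq _ s t => fun rho sigma => eq_value (tbind rho sigma s) (tbind rho sigma t)
  | Neg _ B => fun rho sigma c =>
      ctx c /\ forall c', interp B rho sigma c' -> prov (c ⊕ c')
  | And _ B C => fun rho sigma c => interp B rho sigma c /\ interp C rho sigma c
  | Or _ B C => fun rho sigma =>
      cl (fun c => interp B rho sigma c \/ interp C rho sigma c)
  | Imp _ B C => fun rho sigma c =>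
      ctx c /\ forall c', interp B rho sigma c' -> interp C rho sigma (c ⊕ c')
  | All _ B => fun rho sigma => all_value (fun t => interp B rho (scons t sigma))
  | Ex _ B => fun rho sigma => ex_value (fun t => interp B rho (scons t sigma))
  end.

Lemma mergeA (S T U : sequent L) : S ⊕ (T ⊕ U) = S ⊕ T ⊕ U.
Proof. by rewrite /merge /= !catA. Qed.

Lemma cl_in (X : sequent L -> Prop) c : ctx c -> X c -> cl X c.
Proof. by move=> Hc Hx; split=> // τ [_]; apply. Qed.

Lemma cl_closed X c : ctx c -> (forall τ, dual (cl X) τ -> prov (c ⊕ τ)) -> cl X c.
Proof.
move=> Hc H; split=> // τ Hτ; apply: H; split; first by case: Hτ.
by move=> c' [_]; apply.
Qed.

Lemma interp_ctx n (A : sform L n) rho sigma c : interp A rho sigma c -> ctx c.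
Proof.
elim: A rho sigma => {n} /= [n p ts|n s t|n A IH|n A IHA B IHB|n A IHA B IHB|n A IHA B IHB
  |n A IH|n A IH] rho sigma; try by case.
- by case=> /IHA.
- by move=> /(_ (FVar 0)) /IH.
Qed.

Lemma interp_closed n (A : sform L n) rho sigma c : ctx c ->
  (forall τ, dual (interp A rho sigma) τ -> prov (c ⊕ τ)) -> interp A rho sigma c.
Proof.
elim: A rho sigma c => {n} /= [n p ts|n s t|n A IH|n A IHA B IHB|n A IHA B IHB|n A IHA B IHB
  |n A IH|n A IH] rho sigma c Hc H; try exact: cl_closed.
- split=> // c' Hc'; apply: H; split; first exact: ctx_test (interp_ctx Hc').
  by move=> c'' [_]; apply.
- split; [apply: IHA|apply: IHB] => // τ [Ht Hτ]; apply: H; split=> // c' [HA HB]; exact: Hτ.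
- split=> // c' Hc'; have Hc'' := interp_ctx Hc'; apply: IHB; first exact: ctx_merge.
  move=> τ [Ht Hτ]; rewrite -mergeA; apply: H; split; first exact: test_merge.
  by move=> c'' [_ Himp]; rewrite mergeA; apply: Hτ; apply: Himp.
- move=> t; apply: IH => // τ [Ht Hτ]; apply: H; split=> // c' Hall; exact: Hτ (Hall t).
Qed.

Lemma dual_sub X τ τ' : (forall c, X c -> ctx c) ->
  dual X τ -> subsequent τ τ' -> test τ' -> dual X τ'.
Proof.
move=> HX [Ht Hτ] [H1 H2] Ht'; split=> // c Hc.
apply: prov_sub (Hτ _ Hc) _ _; last by apply: test_merge => //; apply: HX.
by split=> x /=; rewrite !In_cat => -[]; auto.
Qed.

Lemma interp_sub n (A : sform L n) rho sigma c c' :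
  interp A rho sigma c -> subsequent c c' -> ctx c' -> interp A rho sigma c'.
Proof.
move=> Hc [H1 H2] Hc'; apply: interp_closed => // τ [Ht Hτ].
apply: prov_sub (Hτ _ Hc) _ _; last exact: test_merge.
by split=> x /=; rewrite !In_cat => -[]; auto.
Qed.

(** Contraction lets [c] be used both for entering [X] and for leaving it
towards [Y]. *)
Lemma cl_map X Y c : (forall c', X c' -> ctx c') ->
  (forall c', X c' -> Y (c ⊕ c')) -> cl X c -> cl Y c.
Proof.
move=> HX H [Hc Hcl]; split=> // τ [Ht Hτ].
have H1 : prov (c ⊕ (c ⊕ τ)).
  apply: Hcl; split; first exact: test_merge.
  move=> c' Hc'; apply: prov_sub (Hτ _ (H _ Hc')) _ _; first by solve_sub.
  by have := HX _ Hc'; auto.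
by apply: prov_sub H1 _ _; auto; solve_sub.
Qed.

(** Only the values of the free variables of [A] are compared, so this also gives
coincidence of interpretations, taking the identity substitution. *)
Lemma interp_fbind n (A : sform L n) m (rho : nat -> sterm L m) sigma rho' sigma' rho1 sigma1 :
  (forall v, foccurs v A -> rho1 v = tbind rho' sigma' (rho v)) ->
  (forall i, sigma1 i = tbind rho' sigma' (sigma i)) ->
  interp (fbind A rho sigma) rho' sigma' = interp A rho1 sigma1.
Proof.
have Ht n0 (t : sterm L n0) m0 (r : nat -> sterm L m0) s r' s' r1 s1 :
    (forall v, toccurs v t -> r1 v = tbind r' s' (r v)) ->
    (forall i, s1 i = tbind r' s' (s i)) ->
    tbind r' s' (tbind r s t) = tbind r1 s1 t :> term L.
  by move=> Hr Hs; rewrite tbind_tbind; apply: eq_tbind => // v Hv; rewrite Hr.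
have Hq n0 (B : sform L n0.+1) m0 (r : nat -> sterm L m0)
      (s : 'I_n0 -> sterm L m0) r' s' r1 s1 :
    (forall v, foccurs v B -> r1 v = tbind r' s' (r v)) ->
    (forall i, s1 i = tbind r' s' (s i)) -> forall t : term L,
    (forall v, foccurs v B -> r1 v = tbind r' (scons t s') (shift (r v))) /\
    (forall i, scons t s1 i = tbind r' (scons t s') (up s i)).
  move=> Hr Hs t; split=> [v Hv|i]; first by rewrite tbind_scons_shift Hr.
  rewrite {1}/scons /up; case: unlift => [j|] /=; first by rewrite tbind_scons_shift Hs.
  by rewrite /scons unlift_none.
elim: A m rho sigma rho' sigma' rho1 sigma1 => {n} /=
  [n p ts|n s t|n A IH|n A IHA B IHB|n A IHA B IHB|n A IHA B IHB|n A IH|n A IH]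
  m rho sigma rho' sigma' rho1 sigma1 Hr Hs.
- congr atom_value; apply/ffunP=> k; rewrite !ffunE; apply: Ht => // v Hv.
  by apply: Hr; apply/existsP; exists k.
- by congr eq_value; apply: Ht => // v Hv; apply: Hr; rewrite Hv ?orbT.
- by rewrite (IH _ _ _ _ _ rho1 sigma1).
- by rewrite (IHA _ _ _ _ _ rho1 sigma1) ?(IHB _ _ _ _ _ rho1 sigma1) // => v Hv;
    apply: Hr; rewrite Hv ?orbT.
- by rewrite (IHA _ _ _ _ _ rho1 sigma1) ?(IHB _ _ _ _ _ rho1 sigma1) // => v Hv;
    apply: Hr; rewrite Hv ?orbT.
- by rewrite (IHA _ _ _ _ _ rho1 sigma1) ?(IHB _ _ _ _ _ rho1 sigma1) // => v Hv;
    apply: Hr; rewrite Hv ?orbT.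
- congr all_value; apply: functional_extensionality => t.
  by have [H1 H2] := Hq _ _ _ _ _ _ _ _ _ Hr Hs t; apply: IH.
- congr ex_value; apply: functional_extensionality => t.
  by have [H1 H2] := Hq _ _ _ _ _ _ _ _ _ Hr Hs t; apply: IH.
Qed.

Lemma eq_interp n (A : sform L n) rho sigma rho' sigma' :
  (forall v, foccurs v A -> rho v = rho' v) -> sigma =1 sigma' ->
  interp A rho sigma = interp A rho' sigma'.
Proof. by move=> Hr Hs; rewrite -{1}[A]fbind_id; apply: interp_fbind => [v /Hr|i /=]. Qed.

(** Replacement in the model: it reduces to atoms and equations, where it holds
because convertibility is transitive, that is, because rewriting is confluent. *)
Lemma interp_conv n (A : sform L n) c rho rho' (sigma sigma' : 'I_n -> term L) :
  (forall v, conv c (rho v) (rho' v)) -> (forall i, conv c (sigma i) (sigma' i)) ->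
  interp A rho sigma c -> interp A rho' sigma' c.
Proof.
have up c1 c2 s t : ctx c1 -> ctx c2 -> conv c1 s t -> conv (c1 ⊕ c2) s t /\ conv (c2 ⊕ c1) s t.
  by move=> H1 H2 H; split; apply: conv_mono H; auto; solve_sub.
elim: A c rho rho' sigma sigma' => {n} /=
  [n p ts|n s t|n A IH|n A IHA B IHB|n A IHA B IHB|n A IHA B IHB|n A IH|n A IH]
  c rho rho' sigma sigma' Hr Hs Hc.
- have Hcc : ctx c by case: Hc.
  apply: cl_map Hc => c' [] // Hc' [us Hus Hconv]; split; first exact: ctx_merge.
  exists us; first by apply: asserts_mono Hus; auto; solve_sub.
  move=> k; apply: conv_trans (proj2 (up _ _ _ _ Hc' Hcc (Hconv k))) _; auto.
  rewrite !ffunE; apply: (proj1 (up _ _ _ _ Hcc Hc' _)).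
  exact: conv_tbind.
- have Hcc : ctx c by case: Hc.
  apply: cl_map Hc => c' [] // Hc' Hst; split; first exact: ctx_merge.
  have Hx u : conv (c ⊕ c') (tbind rho sigma u) (tbind rho' sigma' u).
    by apply: (proj1 (up _ _ _ _ Hcc Hc' _)); apply: conv_tbind.
  apply: conv_trans (conv_sym (Hx s)) _; auto.
  by apply: conv_trans (proj2 (up _ _ _ _ Hc' Hcc Hst)) _; auto.
- case: Hc => Hc Hneg; split=> // c' HA; have Hc' := interp_ctx HA.
  have HA' : interp A rho sigma (c ⊕ c').
    apply: IH (interp_sub HA _ _); auto; last by solve_sub.
    + by move=> v; apply: conv_sym; apply: (proj1 (up _ _ _ _ Hc Hc' _)).
    + by move=> i; apply: conv_sym; apply: (proj1 (up _ _ _ _ Hc Hc' _)).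
  by apply: prov_sub (Hneg _ HA') _ _; auto; solve_sub.
- by case: Hc => HA HB; split; [apply: IHA HA|apply: IHB HB].
- have Hcc : ctx c by case: Hc.
  apply: cl_map Hc => c'; first by case=> /interp_ctx.
  case=> H; have Hc' := interp_ctx H; [left; apply: IHA (interp_sub H _ _)|
    right; apply: IHB (interp_sub H _ _)]; auto; try solve_sub;
    by move=> v; apply: (proj1 (up _ _ _ _ Hcc Hc' _)).
- case: Hc => Hc Himp; split=> // c' HA; have Hc' := interp_ctx HA.
  have HA' : interp A rho sigma (c ⊕ c').
    apply: IHA (interp_sub HA _ _); auto; last by solve_sub.
    + by move=> v; apply: conv_sym; apply: (proj1 (up _ _ _ _ Hc Hc' _)).
    + by move=> i; apply: conv_sym; apply: (proj1 (up _ _ _ _ Hc Hc' _)).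
  have HB := Himp _ HA'; apply: IHB (interp_sub HB _ _); auto; last by solve_sub.
  + by move=> v; apply: (proj1 (up _ _ _ _ Hc Hc' _)).
  + by move=> v; apply: (proj1 (up _ _ _ _ Hc Hc' _)).
- move=> t; apply: IH (Hc t) => // i; rewrite /scons; case: unlift => // *; exact: conv_refl.
- have Hcc : ctx c by case: Hc.
  apply: cl_map Hc => c' [t H]; first exact: interp_ctx H.
  have Hc' := interp_ctx H; exists t; apply: IH (interp_sub H _ _); auto; last by solve_sub.
  + by move=> v; apply: (proj1 (up _ _ _ _ Hcc Hc' _)).
  + move=> i; rewrite /scons; case: unlift => *; last exact: conv_refl.
    exact: (proj1 (up _ _ _ _ Hcc Hc' _)).
Qed.


(** * Soundness with cut *)

Definition holds rho (Γ : seq (formula L)) (c : sequent L) : Prop :=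
  forall A, List.In A Γ -> interp A rho BVar c.

Definition refuted rho (Δ : seq (formula L)) (τ : sequent L) : Prop :=
  forall A, List.In A Δ -> dual (interp A rho BVar) τ.

(** One context for all antecedent formulas and one test for all succedent
formulas suffice, since closed sets are stable under enlarging the context and
contraction is available. Only the sets of formulas of [S] matter, so the
structural rules are sound at once. *)
Definition valid (S : sequent L) : Prop := forall rho c τ, ctx c -> test τ ->
  holds rho (antecedent S) c -> refuted rho (succedent S) τ -> prov (c ⊕ τ).

Lemma holds_rcons rho Γ F c :
  holds rho (rcons Γ F) c <-> holds rho Γ c /\ interp F rho BVar c.
Proof.
split=> [H|[H HF] A]; last by rewrite In_rcons => -[/H|->].
by split=> [A HA|]; apply: H; rewrite In_rcons; auto.
Qed.

Lemma refuted_rcons rho Δ F τ :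
  refuted rho (rcons Δ F) τ <-> refuted rho Δ τ /\ dual (interp F rho BVar) τ.
Proof.
split=> [H|[H HF] A]; last by rewrite In_rcons => -[/H|->].
by split=> [A HA|]; apply: H; rewrite In_rcons; auto.
Qed.

Lemma holds_cat rho Γ Λ c : holds rho (Γ ++ Λ) c <-> holds rho Γ c /\ holds rho Λ c.
Proof.
split=> [H|[H H'] A]; last by rewrite In_cat => -[/H|/H'].
by split=> A HA; apply: H; rewrite In_cat; auto.
Qed.

Lemma refuted_cat rho Δ Θ τ :
  refuted rho (Δ ++ Θ) τ <-> refuted rho Δ τ /\ refuted rho Θ τ.
Proof.
split=> [H|[H H'] A]; last by rewrite In_cat => -[/H|/H'].
by split=> A HA; apply: H; rewrite In_cat; auto.
Qed.

Lemma holds_sub rho Γ c c' : holds rho Γ c -> subsequent c c' -> ctx c' -> holds rho Γ c'.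
Proof. by move=> H Hs Hc A /H HA; apply: interp_sub HA _ _. Qed.

Lemma refuted_sub rho Δ τ τ' :
  refuted rho Δ τ -> subsequent τ τ' -> test τ' -> refuted rho Δ τ'.
Proof.
by move=> H Hs Hc A /H HA; apply: dual_sub HA _ _ => // c HAc; apply: interp_ctx HAc.
Qed.

Lemma sub_merge (S T U : sequent L) : subsequent S U -> subsequent T U -> subsequent (S ⊕ T) U.
Proof. by move=> [H1 H2] [H3 H4]; split=> x; rewrite In_cat => -[]; auto. Qed.

(** Classically the test [τ] is itself a context and may be moved to the left;
intuitionistically the side formulas [Δ] are absent and [c] alone does. *)
Lemma split_context Γ Δ F rho c τ : test (Γ ⇒ rcons Δ F) -> ctx c -> refuted rho Δ τ ->
  test τ -> exists e, [/\ ctx e, subsequent c e, subsequent e (c ⊕ τ) & refuted rho Δ e].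
Proof.
move=> Ht Hc HΔ Hτ; case: (orP (orbN int)) => Hint.
  exists c; split=> //; [by solve_sub|by solve_sub|].
  by move: (Ht Hint); rewrite /= size_rcons; case: (Δ) => // _ A [].
exists (c ⊕ τ); split; [by move=> E; rewrite E in Hint|by solve_sub|by solve_sub|].
by apply: refuted_sub HΔ _ _; [solve_sub|apply: test_merge].
Qed.

(** Validity of a sequent with a distinguished succedent formula, in natural
deduction style: right rules are checked as in a Heyting algebra. *)
Lemma valid_right Γ Δ F : test (Γ ⇒ rcons Δ F) ->
  valid (Γ ⇒ rcons Δ F) <->
  (forall rho c, ctx c -> holds rho Γ c -> refuted rho Δ c -> interp F rho BVar c).
Proof.
move=> Ht; split=> [H rho c Hc HΓ HΔ|H rho c τ Hc Hτ HΓ /refuted_rcons[/= HΔ HF]].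
  apply: interp_closed => // τ Hτ; have Htτ : test τ by case: Hτ.
  have H1 : prov (c ⊕ (c ⊕ τ)).
    apply: (H rho) => //=; first exact: test_merge.
    apply/refuted_rcons; split; first by apply: refuted_sub HΔ _ _; auto; solve_sub.
    by apply: dual_sub Hτ _ _; auto; [move=> c'; apply: interp_ctx|solve_sub].
  by apply: prov_sub H1 _ _; auto; solve_sub.
have [e [He He1 He2 HeΔ]] := split_context Ht Hc HΔ Hτ.
have HeF : interp F rho BVar e by apply: H => //; exact: holds_sub HΓ He1 He.
apply: prov_sub ((proj2 HF) _ HeF) _ _; last exact: test_merge.
by apply: sub_merge => //; solve_sub.
Qed.

Lemma valid_right_elim Γ Δ F rho c τ : test (Γ ⇒ rcons Δ F) -> valid (Γ ⇒ rcons Δ F) ->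
  ctx c -> test τ -> holds rho Γ c -> refuted rho Δ τ ->
  exists e, [/\ ctx e, subsequent c e, subsequent e (c ⊕ τ) & interp F rho BVar e].
Proof.
move=> Ht /(valid_right Ht) H Hc Hτ HΓ HΔ.
have [e [He He1 He2 HeΔ]] := split_context Ht Hc HΔ Hτ.
by exists e; split=> //; apply: H => //; exact: holds_sub HΓ He1 He.
Qed.

Lemma interp_inst (A : sform L 1) t rho :
  interp (inst A t) rho BVar = interp A rho (scons (tbind rho BVar t) BVar).
Proof. by apply: interp_fbind => // i; rewrite /scons; case: unlift => // -[]. Qed.

Lemma interp_fsubst (F : formula L) v t rho : interp (fsubst F v t) rho BVar =
  interp F (fun w => if w == v then tbind rho BVar t else rho w) BVar.
Proof. by apply: interp_fbind => [w _|//]; case: eqP. Qed.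

Lemma interp_update (A : formula L) v t rho : ~~ foccurs v A ->
  interp A (fun w => if w == v then t else rho w) BVar = interp A rho BVar.
Proof.
move=> Hv; apply: eq_interp => // w Hw; case: eqP => // E.
by rewrite E (negbTE Hv) in Hw.
Qed.

Lemma interp_eigenvariable (A : sform L 1) v t rho : ~~ foccurs v A ->
  interp (inst A (FVar v)) (fun w => if w == v then t else rho w) BVar =
  interp A rho (scons t BVar).
Proof.
move=> Hv; rewrite interp_inst /= eqxx; apply: eq_interp => // w Hw.
by case: eqP => // E; rewrite E (negbTE Hv) in Hw.
Qed.

(** Membership in the interpretation of [r = s] only says that [c] belongs to the
closure of the contexts making [r] and [s] convertible; as the interpretation of
[F] is closed, it is enough to test [c] extended by such contexts. *)
Lemma interp_leibniz (F : formula L) v r s rho c :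
  interp (Eq r s) rho BVar c ->
  interp (fsubst F v r) rho BVar c <-> interp (fsubst F v s) rho BVar c.
Proof.
move=> /= Heq; have Hc : ctx c by case: Heq.
have dir a b : (forall c', conv c' (tbind rho BVar r) (tbind rho BVar s) ->
      conv c' (tbind rho BVar a) (tbind rho BVar b)) ->
    interp (fsubst F v a) rho BVar c -> interp (fsubst F v b) rho BVar c.
  move=> Hab HF; apply: interp_closed => // τ [Ht Hτ].
  have H : prov (c ⊕ (c ⊕ τ)).
    apply: (proj2 Heq); split; first exact: test_merge.
    move=> c' [Hc' Hrs].
    have HF' : interp (fsubst F v a) rho BVar (c ⊕ c').
      by apply: interp_sub HF _ _; auto; solve_sub.
    have HF'' : interp (fsubst F v b) rho BVar (c ⊕ c').
      move: HF'; rewrite !interp_fsubst; apply: interp_conv => [w|i]; last exact: conv_refl.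
      case: eqP => _; last exact: conv_refl.
      by apply: Hab; apply: conv_mono Hrs; auto; solve_sub.
    by apply: prov_sub (Hτ _ HF'') _ _; auto; solve_sub.
  by apply: prov_sub H _ _; auto; solve_sub.
by split; apply: dir => // c'; apply: conv_sym.
Qed.

Lemma holds_update rho v t Γ c : ~~ has (foccurs v) Γ ->
  holds rho Γ c -> holds (fun w => if w == v then t else rho w) Γ c.
Proof.
move=> Hv H A HA; rewrite interp_update; first exact: H.
by elim: Γ Hv HA {H} => //= B Γ IH; rewrite negb_or => /andP[H1 H2] [<-|/(IH H2)].
Qed.

Lemma refuted_update rho v t Δ τ : ~~ has (foccurs v) Δ ->
  refuted rho Δ τ -> refuted (fun w => if w == v then t else rho w) Δ τ.
Proof.
move=> Hv H A HA; rewrite interp_update; first exact: H.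
by elim: Δ Hv HA {H} => //= B Γ IH; rewrite negb_or => /andP[H1 H2] [<-|/(IH H2)].
Qed.

Lemma gentzen_sound prems concl : gentzen_rule prems concl ->
  (forall S, List.In S (concl :: prems) -> test S) ->
  (forall S, List.In S prems -> valid S) -> valid concl.
Proof.
case=> {prems concl} [F|Γ Δ F|Γ Δ F|Γ Λ Δ F G|Γ Δ Θ F G|Γ Δ F|Γ Δ F|Γ Δ F|Γ Δ F|Γ Δ F G|Γ Δ F G
  |Γ Δ F G|Γ Δ F G|Γ Δ F G|Γ Δ F G|Γ Λ Δ Θ F G|Γ Δ F G|Γ Δ A t|Γ Δ A v Hv|Γ Δ A v Hv|Γ Δ A t]
  Ht Hval.
all: have Ht0 := Ht _ (or_introl erefl).
all: try have Ht1 := Ht _ (or_intror (or_introl erefl)).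
all: try have Ht2 := Ht _ (or_intror (or_intror (or_introl erefl))).
all: try have V1 := Hval _ (or_introl erefl).
all: try have V2 := Hval _ (or_intror (or_introl erefl)).
all: move=> {Ht Hval}.
- by move=> rho c τ Hc _ HF Hτ; apply: (proj2 (Hτ F _)) => /=; auto; apply: HF; left.
- by move=> rho c τ Hc Hτ /holds_rcons[HΓ _] HΔ; apply: V1 HΔ.
- by move=> rho c τ Hc Hτ HΓ /refuted_rcons[HΔ _]; apply: V1 HΔ.
- move=> rho c τ Hc Hτ HΓ; apply: V1 => // A HA; apply: HΓ.
  by move: HA; rewrite /= !In_cat /=; tauto.
- move=> rho c τ Hc Hτ HΓ HΔ; apply: (V1 rho) => // A HA; apply: HΔ.
  by move: HA; rewrite /= !In_cat /=; tauto.
- move=> rho c τ Hc Hτ /holds_rcons[HΓ HF] HΔ; apply: V1 HΔ => //.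
  by apply/holds_rcons; split=> //; apply/holds_rcons.
- move=> rho c τ Hc Hτ HΓ /refuted_rcons[HΔ HF]; apply: (V1 rho) => //.
  by apply/refuted_rcons; split=> //; apply/refuted_rcons.
- move=> rho c τ Hc Hτ /holds_rcons[HΓ [_ HF]] HΔ.
  have [e [He He1 He2 HeF]] := valid_right_elim Ht1 V1 Hc Hτ HΓ HΔ.
  apply: prov_sub (HF _ HeF) _ _; last exact: test_merge.
  by apply: sub_merge => //; solve_sub.
- apply/(valid_right Ht0) => rho c Hc HΓ HΔ /=; split=> // c' HF.
  have Hc' := interp_ctx HF; have H : prov ((c ⊕ c') ⊕ c).
    apply: (V1 rho); auto; apply/holds_rcons; split.
      by apply: holds_sub HΓ _ _; auto; solve_sub.
    by apply: interp_sub HF _ _; auto; solve_sub.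
  by apply: prov_sub H _ _; auto; solve_sub.
- by move=> rho c τ Hc Hτ /holds_rcons[HΓ [HF _]] HΔ; apply: V1 HΔ => //; apply/holds_rcons.
- by move=> rho c τ Hc Hτ /holds_rcons[HΓ [_ HF]] HΔ; apply: V1 HΔ => //; apply/holds_rcons.
- move/(valid_right Ht1): V1 => V1; move/(valid_right Ht2): V2 => V2.
  by apply/(valid_right Ht0) => rho c Hc HΓ HΔ; split; auto.
- move=> rho c τ Hc Hτ /holds_rcons[HΓ [_ HFG]] HΔ.
  have H : prov (c ⊕ (c ⊕ τ)).
    apply: HFG; split; first exact: test_merge.
    move=> c' HFG; have Hc' : ctx c' by case: HFG => /interp_ctx.
    have HΓ' : holds rho Γ (c ⊕ c') by apply: holds_sub HΓ _ _; auto; solve_sub.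
    have H : prov (c ⊕ c' ⊕ τ).
      by case: HFG => H; [apply: (V1 rho)|apply: (V2 rho)]; auto; apply/holds_rcons; split=> //;
        apply: interp_sub H _ _; auto; solve_sub.
    by apply: prov_sub H _ _; auto; solve_sub.
  by apply: prov_sub H _ _; auto; solve_sub.
- move/(valid_right Ht1): V1 => V1.
  by apply/(valid_right Ht0) => rho c Hc HΓ HΔ; apply: cl_in; auto; left; apply: V1.
- move/(valid_right Ht1): V1 => V1.
  by apply/(valid_right Ht0) => rho c Hc HΓ HΔ; apply: cl_in; auto; right; apply: V1.
- move=> rho c τ Hc Hτ /holds_rcons[/holds_cat[HΓ HΛ] [_ HFG]] /refuted_cat[HΔ HΘ].
  have [e [He He1 He2 HeF]] := valid_right_elim Ht1 V1 Hc Hτ HΓ HΔ.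
  have HG := HFG _ HeF; have H : prov (c ⊕ e ⊕ τ).
    apply: (V2 rho); auto; apply/holds_rcons; split=> //.
    by apply: holds_sub HΛ _ _; auto; solve_sub.
  by apply: prov_sub H _ _; last (exact: test_merge); do 2?apply: sub_merge => //; solve_sub.
- move/(valid_right Ht1): V1 => V1.
  apply/(valid_right Ht0) => rho c Hc HΓ HΔ; split=> // c' HF; have Hc' := interp_ctx HF.
  apply: V1; auto; last by apply: refuted_sub HΔ _ _; auto; solve_sub.
  apply/holds_rcons; split; first by apply: holds_sub HΓ _ _; auto; solve_sub.
  by apply: interp_sub HF _ _; auto; solve_sub.
- move=> rho c τ Hc Hτ /holds_rcons[HΓ HA] HΔ; apply: V1 HΔ => //.
  by apply/holds_rcons; split=> //; rewrite interp_inst; apply: HA.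
- move/(valid_right Ht1): V1 => V1; move: Hv; rewrite /soccurs has_rcons /= !negb_or.
  case/and3P=> HvΓ HvA HvΔ; apply/(valid_right Ht0) => rho c Hc HΓ HΔ t.
  change (interp A rho (scons t BVar) c).
  rewrite -(interp_eigenvariable _ _ HvA); apply: V1 => //; first exact: holds_update.
  exact: refuted_update.
- move: Hv; rewrite /soccurs has_rcons /= !negb_or => /andP[/andP[HvA HvΓ] HvΔ].
  move=> rho c τ Hc Hτ /holds_rcons[HΓ HA] HΔ.
  have H : prov (c ⊕ (c ⊕ τ)).
    apply: (proj2 HA); split; first exact: test_merge.
    move=> c' [t HAt]; have Hc' := interp_ctx HAt.
    have H : prov (c ⊕ c' ⊕ τ).
      apply: (V1 (fun w => if w == v then t else rho w)); auto; last exact: refuted_update.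
      apply/holds_rcons; split.
        by apply: holds_update => //; apply: holds_sub HΓ _ _; auto; solve_sub.
      by rewrite interp_eigenvariable //; apply: interp_sub HAt _ _; auto; solve_sub.
    by apply: prov_sub H _ _; auto; solve_sub.
  by apply: prov_sub H _ _; auto; solve_sub.
- move/(valid_right Ht1): V1 => V1.
  apply/(valid_right Ht0) => rho c Hc HΓ HΔ; apply: cl_in => //.
  exists (tbind rho BVar t); change (interp A rho (scons (tbind rho BVar t) BVar) c).
  by rewrite -interp_inst; apply: V1.
Qed.

Lemma cut_sound prems concl : cut_rule prems concl ->
  (forall S, List.In S (concl :: prems) -> test S) ->
  (forall S, List.In S prems -> valid S) -> valid concl.
Proof.
case=> {prems concl} Γ Λ Δ Θ F Ht Hval.
have Ht1 := Ht _ (or_intror (or_introl erefl)).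
have V1 := Hval _ (or_introl erefl); have V2 := Hval _ (or_intror (or_introl erefl)).
move=> rho c τ Hc Hτ /holds_cat[HΓ HΛ] /refuted_cat[HΔ HΘ].
have [e [He He1 He2 HeF]] := valid_right_elim Ht1 V1 Hc Hτ HΓ HΔ.
have H : prov (e ⊕ τ).
  by apply: (V2 rho); auto; apply/holds_rcons; split=> //; apply: holds_sub HΛ _ _.
by apply: prov_sub H _ _; last (exact: test_merge); apply: sub_merge => //; solve_sub.
Qed.

Lemma refl_sound prems concl : refl_rule prems concl -> valid concl.
Proof.
case=> {prems concl} t; apply/(@valid_right [::] [::] (Eq t t)) => // rho c Hc _ _.
by apply: cl_in => //; split=> //; apply: conv_refl.
Qed.

Lemma replacement_sound_right Γ Δ F v r s E : E = Eq r s \/ E = Eq s r ->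
  test (Γ ⇒ rcons Δ (fsubst F v r)) -> test (rcons Γ E ⇒ rcons Δ (fsubst F v s)) ->
  valid (Γ ⇒ rcons Δ (fsubst F v r)) -> valid (rcons Γ E ⇒ rcons Δ (fsubst F v s)).
Proof.
move=> HE Ht1 Ht0 /(valid_right Ht1) V1; apply/(valid_right Ht0).
move=> rho c Hc /holds_rcons[HΓ Hrs] HΔ; have HF := V1 rho c Hc HΓ HΔ.
by case: HE Hrs => -> Hrs; [apply/(interp_leibniz _ _ Hrs)|apply/(interp_leibniz _ _ Hrs)].
Qed.

Lemma replacement_sound_left Γ Δ F v r s E : E = Eq r s \/ E = Eq s r ->
  valid (rcons Γ (fsubst F v r) ⇒ Δ) -> valid (rcons (rcons Γ (fsubst F v s)) E ⇒ Δ).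
Proof.
move=> HE V1 rho c τ Hc Hτ /holds_rcons[/holds_rcons[HΓ HF] Hrs] HΔ.
apply: V1 HΔ => //; apply/holds_rcons; split=> //.
by case: HE Hrs => -> Hrs; [apply/(interp_leibniz _ _ Hrs)|apply/(interp_leibniz _ _ Hrs)].
Qed.

Lemma eq_rule_sound prems concl : @eq_rule d L prems concl ->
  (forall S, List.In S (concl :: prems) -> test S) ->
  (forall S, List.In S prems -> valid S) -> valid concl.
Proof.
rewrite /eq_rule; case: d => -[] {prems concl} Γ Δ F v r s _ _ Ht Hval;
  have V1 := Hval _ (or_introl erefl);
  have [Ht0 Ht1] := (Ht _ (or_introl erefl), Ht _ (or_intror (or_introl erefl))).
- by apply: replacement_sound_right V1; auto.
- by apply: replacement_sound_left V1; auto.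
- by apply: replacement_sound_right V1; auto.
- by apply: replacement_sound_left V1; auto.
Qed.

Lemma derivable_test S : derivable (withcut int d (L := L)) S -> test S.
Proof.
case=> prems concl; rewrite /withcut /test; case: int => // -[_ H] _ _.
by apply: H; left.
Qed.

Lemma soundness S : derivable (withcut int d (L := L)) S -> valid S.
Proof.
move=> H; have Ht0 := derivable_test H.
elim: H Ht0 => {S} prems concl HR Hprems IH Ht0.
have Ht S : List.In S (concl :: prems) -> test S.
  by case=> [<- //|/Hprems]; apply: derivable_test.
have Hval S : List.In S prems -> valid S by move=> HS; apply: IH => //; apply: Ht; right.
have: (@gentzen_rule L ∪ @refl_rule L ∪ @eq_rule d L ∪ @cut_rule L) prems concl.
  by move: HR; rewrite /withcut; case: int => // -[].
case=> [[[H|H]|H]|H].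
- exact: gentzen_sound H Ht Hval.
- exact: refl_sound H.
- exact: eq_rule_sound H Ht Hval.
- exact: cut_sound H Ht Hval.
Qed.

(** * Completeness without cut *)

Ltac solve_test :=
  let Hi := fresh "Hi" in move=> Hi; rewrite /=;
  repeat match goal with
  | H : ctx _ |- _ => rewrite ?(H Hi); clear H
  | H : test _ |- _ => move: (H Hi); clear H
  end; rewrite /=; auto.

Lemma prov_step1 S S' concl T : gentzen_rule [:: S'] concl -> prov S ->
  subsequent S S' -> subsequent concl T -> test S' -> test concl -> test T -> prov T.
Proof.
move=> HR H H1 H2 Ht1 Ht2 Ht3; apply: prov_sub H2 Ht3; apply: prov_gentzen1 HR Ht2 _.
exact: prov_sub H H1 Ht1.
Qed.

Lemma prov_step2 S1 S2 S1' S2' concl T : gentzen_rule [:: S1'; S2'] concl ->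
  prov S1 -> prov S2 -> subsequent S1 S1' -> subsequent S2 S2' -> subsequent concl T ->
  test S1' -> test S2' -> test concl -> test T -> prov T.
Proof.
move=> HR H1 H2 HS1 HS2 HS Ht1 Ht2 Ht Ht'; apply: prov_sub HS Ht'.
by apply: prov_gentzen2 HR Ht _ _; [apply: prov_sub H1 _ _|apply: prov_sub H2 _ _].
Qed.

(** The left component is what the left rule of the main connective gives, the
right component what its right rule gives; for quantifiers the eigenvariable is
a term like any other, chosen fresh for the context. *)
Lemma adequacy n (A : sform L n) rho sigma :
  interp A rho sigma ([:: fbind A rho sigma] ⇒ [::]) /\
  forall c, interp A rho sigma c -> prov (c ⊕ ([::] ⇒ [:: fbind A rho sigma])).
Proof.
elim: A rho sigma => {n} [n p ts|n s t|n A IH|n A IHA B IHB|n A IHA B IHB|n A IHA B IHB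
  |n A IH|n A IH] rho sigma.
- split=> [|c [Hc]].
    apply: cl_in => //; split=> //; exists [ffun k => tbind rho sigma (ts k)] => [τ Ht //|k].
    exact: conv_refl.
  apply; split=> // c' [Hc' [us Hus Hconv]].
  have H : prov (c' ⊕ (c' ⊕ ([::] ⇒ [:: Atom [ffun k => tbind rho sigma (ts k)]]))).
    by apply: Hus; auto; apply: conv_prov_atom.
  by apply: prov_sub H _ _; auto; solve_sub.
- split=> [|c [Hc]]; last by apply; split=> // c' [Hc' Hst]; apply: conv_prov_eq.
  by apply: cl_in => //; split=> //; apply: asserts_conv.
- have [HL HR] := IH rho sigma; split=> [|c [Hc HF]].
    split=> // c' HA; have Hc' := interp_ctx HA.
    apply: (prov_step1 (NegL (antecedent c') (succedent c') _) (HR _ HA));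
      by [solve_sub|solve_test].
  apply: (prov_step1 (NegR (antecedent c) (succedent c) _) (HF _ HL));
    by [solve_sub|solve_test].
- have [HLA HRA] := IHA rho sigma; have [HLB HRB] := IHB rho sigma; split=> [|c [HA HB]].
    split; apply: interp_closed => // τ [Ht Hτ].
    + apply: (prov_step1 (AndL1 (antecedent τ) (succedent τ) _ _) (Hτ _ HLA));
        by [solve_sub|solve_test].
    + apply: (prov_step1 (AndL2 (antecedent τ) (succedent τ) _ _) (Hτ _ HLB));
        by [solve_sub|solve_test].
  have Hc := interp_ctx HA.
  apply: (prov_step2 (AndR (antecedent c) (succedent c) _ _) (HRA _ HA) (HRB _ HB));
    by [solve_sub|solve_test].
- have [HLA HRA] := IHA rho sigma; have [HLB HRB] := IHB rho sigma; split=> [|c [_]].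
    split=> // τ [Ht Hτ].
    apply: (prov_step2 (OrL (antecedent τ) (succedent τ) _ _) (Hτ _ (or_introl HLA))
      (Hτ _ (or_intror HLB))); by [solve_sub|solve_test].
  apply; split=> // c' [HA|HB].
  + have Hc := interp_ctx HA.
    apply: (prov_step1 (OrR1 (antecedent c') (succedent c') _ _) (HRA _ HA));
      by [solve_sub|solve_test].
  + have Hc := interp_ctx HB.
    apply: (prov_step1 (OrR2 (antecedent c') (succedent c') _ _) (HRB _ HB));
      by [solve_sub|solve_test].
- have [HLA HRA] := IHA rho sigma; have [HLB HRB] := IHB rho sigma; split=> [|c [Hc HF]].
    split=> // c' HA; have Hc' := interp_ctx HA.
    apply: interp_closed => [|τ [Ht Hτ]]; first exact: ctx_merge.
    apply: (prov_step2 (ImpL (antecedent c') (antecedent τ) (succedent c') (succedent τ) _ _)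
      (HRA _ HA) (Hτ _ HLB)); by [solve_sub|solve_test].
  apply: (prov_step1 (ImpR (antecedent c) (succedent c) _ _) (HRB _ (HF _ HLA)));
    by [solve_sub|solve_test].
- split=> [t|c Hall].
    have [HL HR] := IH rho (scons t sigma); apply: interp_closed => // τ [Ht Hτ].
    have H := Hτ _ HL; rewrite -inst_fbind in H.
    apply: (prov_step1 (AllL (antecedent τ) (succedent τ) _ _) H); by [solve_sub|solve_test].
  have Hc := interp_ctx Hall.
  have [v Hv] := soccurs_bound (antecedent c ⇒ rcons (succedent c) (fbind (All A) rho sigma)).
  have H := proj2 (IH rho (scons (FVar v) sigma)) _ (Hall (FVar v)); rewrite -inst_fbind in H.
  apply: (prov_step1 (AllR (Hv v (leqnn v))) H); by [solve_sub|solve_test].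
- split=> [|c [_]].
    split=> // τ [Ht Hτ].
    have [v Hv] := soccurs_bound (rcons (antecedent τ) (fbind (Ex A) rho sigma) ⇒ succedent τ).
    have H : prov (([:: fbind A rho (scons (FVar v) sigma)] ⇒ [::]) ⊕ τ).
      by apply: Hτ; exists (FVar v); apply: (proj1 (IH _ _)).
    rewrite -inst_fbind in H.
    apply: (prov_step1 (ExL (Hv v (leqnn v))) H); by [solve_sub|solve_test].
  apply; split=> // c' [t HA]; have Hc' := interp_ctx HA.
  have H := proj2 (IH _ _) _ HA; rewrite -inst_fbind in H.
  apply: (prov_step1 (ExR (antecedent c') (succedent c') _ t) H); by [solve_sub|solve_test].
Qed.

(** Evaluate validity at the context [Γ ⇒], the test [⇒ Δ] and the identity
valuation. *)
Lemma completeness Γ Δ : test (Γ ⇒ Δ) -> valid (Γ ⇒ Δ) -> prov (Γ ⇒ Δ).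
Proof.
move=> Ht H; have: prov ((Γ ⇒ [::]) ⊕ ([::] ⇒ Δ)).
  apply: (H FVar) => // A HA; have [HL HR] := adequacy A FVar BVar; rewrite fbind_id in HL HR.
    by apply: interp_sub HL _ _ => //; split=> // x [<-|[]].
  split=> // c Hc; apply: prov_sub (HR _ Hc) _ _;
    last by apply: test_merge => //; apply: interp_ctx Hc.
  split=> // x; rewrite /= !In_cat /=; case; auto; case=> // <-; auto.
by rewrite /merge /= cats0.
Qed.

End Model.

Theorem cut_elimination (L : language) (int d : bool) (S : sequent L) :
  derivable (withcut int d (L := L)) S -> derivable (cutfree int d (L := L)) S.
Proof.
case: S => Γ Δ H; apply: completeness (soundness H).
exact: derivable_test H.
Qed.

Theorem theorem1p6 (L : language) :
  (forall S : sequent L, derivable (@LJ1 L) S -> derivable (@LJ1_cutfree L) S) /\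
  (forall S : sequent L, derivable (@LJ2 L) S -> derivable (@LJ2_cutfree L) S) /\
  (forall S : sequent L, derivable (@LK1 L) S -> derivable (@LK1_cutfree L) S) /\
  (forall S : sequent L, derivable (@LK2 L) S -> derivable (@LK2_cutfree L) S).
Proof.
split; [exact: (@cut_elimination L true true)|split; [exact: (@cut_elimination L true false)|]].
by split; [exact: (@cut_elimination L false true)|exact: (@cut_elimination L false false)].
Qed.
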